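(* Let $0<\alpha\le 1$, let $p,q,r>0$ be real constants with $q>p$, and consider the fractional order Mackey-Glass equation $$D^\alpha x(t)=-p\,x(t)+q\,\frac{x(t-\tau)}{1+x(t-\tau)^r},\qquad t>0.$$ Then the equilibrium point $x_1^*=0$ is unstable for every delay $\tau\ge 0$.
   Context: For $0<\alpha<1$, $D^\alpha$ is the Caputo derivative $D^\alpha f(t)=\frac{1}{\Gamma(1-\alpha)}\int_0^t (t-s)^{-\alpha}f'(s)\,ds$, and $D^1f=f'$. The equation is posed with initial data $x(t)=\phi(t)$ for $-\tau\le t\le 0$, where $\phi:[-\tau,0]\to\mathbb{R}$; the solution is denoted $x(t,\phi)$ and $\|\phi\|=\sup_{-\tau\le t\le 0}|\phi(t)|$. When $r$ is not an integer, $x^r$ is the usual real power and the equation is considered where it is defined. An equilibrium point $x_*$ (a constant solution) is stable if for every $\epsilon>0$ there is $\delta>0$ such that $\|\phi-x_*\|<\delta$ implies $|x(t,\phi)-x_*|<\epsilon$ for all $t\ge 0$; it is unstable if it is not stable. *)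

(* Defs.v *)
From HB Require Import structures.
From mathcomp Require Import all_boot all_order all_algebra.
From mathcomp Require Import all_classical all_reals all_analysis.

Set Implicit Arguments.
Unset Strict Implicit.
Unset Printing Implicit Defensive.

Import Order.TTheory GRing.Theory Num.Theory.
Import numFieldNormedType.Exports.

Local Open Scope classical_set_scope.
Local Open Scope ring_scope.

Definition Gamma (R : realType) (z : R) : R :=
  \int[lebesgue_measure]_(u in `]0, +oo[) (u `^ (z - 1) * expR (- u)).

Definition abs_continuous (R : realType) (a b : R) (f : R -> R) : Prop :=
  forall eps : R, 0 < eps -> exists2 delta : R, 0 < delta &
    forall (n : nat) (u v : 'I_n -> R),
      (forall i, a <= u i /\ u i <= v i /\ v i <= b) ->
      trivIset [set: 'I_n] (fun i => `]u i, v i[%classic : set R) ->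
      \sum_(i < n) (v i - u i) < delta ->
      \sum_(i < n) `|f (v i) - f (u i)| < eps.

(* [has_caputo alpha f t y]: the Caputo derivative (with base point 0) of order
   0 < alpha <= 1 of f at t exists and equals y.  For alpha < 1 it is meant for
   absolutely continuous f, for which f' exists almost everywhere; [derive1 f]
   has an irrelevant value at the other points.  Without absolute continuity,
   functions of Cantor type would have a zero Caputo derivative. *)
Definition has_caputo (R : realType) (alpha : R) (f : R -> R) (t y : R) : Prop :=
  if alpha == 1 then is_derive t 1 f y
  else
    let k := fun s : R => (t - s) `^ (- alpha) * derive1 f s in
    [/\ abs_continuous 0 t f,
        lebesgue_measure.-integrable `[0, t] (EFin \o k) &
        y = (Gamma (1 - alpha))^-1 * \int[lebesgue_measure]_(s in `[0, t]) k s].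

(* x^r for a real exponent r > 0: an integer power of an arbitrary real x when
   r is an integer; otherwise the usual real power, which makes sense only for
   x >= 0 ([powR] takes a junk value at x < 0). *)
Definition rpow (R : realType) (x r : R) : R :=
  if r \is a Num.nat then x ^+ Num.truncn r else x `^ r.

Definition rpow_defined (R : realType) (x r : R) : Prop :=
  r \is a Num.nat \/ 0 <= x.

Definition feedback_defined (R : realType) (r x : R) : Prop :=
  rpow_defined x r /\ 1 + rpow x r != 0.

Definition is_solution (R : realType) (alpha p q r tau : R)
    (phi x : R -> R) : Prop :=
  [/\ forall t, - tau <= t <= 0 -> x t = phi t,
      {within `[- tau, +oo[, continuous x} &
      forall t, 0 < t ->
        feedback_defined r (x (t - tau)) /\
        has_caputo alpha x t
          (- p * x t + q * (x (t - tau) / (1 + rpow (x (t - tau)) r)))].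

Definition is_equilibrium (R : realType) (alpha p q r tau xs : R) : Prop :=
  is_solution alpha p q r tau (cst xs) (cst xs).

(* An extended-real supremum, since the real [sup] of an unbounded set is 0. *)
Definition hist_norm (R : realType) (tau : R) (phi : R -> R) : \bar R :=
  ereal_sup [set `|phi t|%:E | t in `[- tau, 0]].

Definition is_stable (R : realType) (alpha p q r tau xs : R) : Prop :=
  forall eps : R, 0 < eps -> exists2 delta : R, 0 < delta &
    forall phi x : R -> R, is_solution alpha p q r tau phi x ->
      (hist_norm tau (fun t => (phi t - xs)%R) < delta%:E)%E ->
      forall t, 0 <= t -> `|x t - xs| < eps.

Definition is_unstable (R : realType) (alpha p q r tau xs : R) : Prop :=
  ~ is_stable alpha p q r tau xs.

(* Main.v *)
(* Arbitrarily small histories are exhibited whose solutions, which have to be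
   constructed, leave a fixed neighbourhood of 0.

   Existence. Writing x = phi + int_0^t s^(a-1) v(s) ds, Abel inversion turns the
   Caputo equation into v = c0 + t^al * (an average of N v), solved by Picard
   iteration in an exponentially weighted supremum norm. If tau = 0 then a = al;
   if tau > 0 the history is chosen so that the right-hand side vanishes at time
   0, which allows a = 1. The feedback y / (1 + y^r) is extended C^1 below a level
   m >= 0 that the solution is shown never to cross.

   Escape. Fix p < q1 < q and e with q y / (1 + y^r) >= q1 y on [0, e]. At the
   first time t1 > 0 where x meets an affine function b + c t from above, the
   Caputo derivative of x is at most that of the affine function, namely
   c * const * t1^(1 - al). For the barrier m1 (1 + d t) with d small this is
   impossible as long as x < e: the right-hand side of the equation is at least
   (q1 - p) m1 d t1 up to a positive constant, and t1^(1 - al) is sublinear. So x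
   stays above an unbounded barrier until it reaches e. *)

(* The unknown of the integral equation is [v], the derivative of the solution with its power factor
   removed, and not the solution itself: the comparison argument needs solutions that have a
   continuous derivative at every positive time. The price is that the new nonlinearity [N] contains
   the product of the derivative of the feedback with [v], which is only locally Lipschitz in [v].
   It still grows linearly, so the Picard iterates are bounded first, and the contraction is set up
   afterwards on the resulting ball.

   An affine barrier is used because its Caputo derivative is a single power of time, found by
   scaling; the exponential growth suggested by linearisation would bring in Mittag-Leffler
   functions, while the escape only needs the barrier to be unbounded. All solutions considered stay
   nonnegative, so the real power always has its usual meaning and the lower bound on the feedback
   near 0 applies. *)
Require Import Defs.
From mathcomp Require Import all_boot all_order all_algebra.
From mathcomp Require Import all_classical all_reals all_analysis.
From mathcomp Require Import measurable_realfun ring lra.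
Import Order.TTheory GRing.Theory Num.Theory.
Import numFieldNormedType.Exports.
Local Open Scope ring_scope.
Local Open Scope classical_set_scope.
Set Implicit Arguments.
Unset Strict Implicit.
Unset Printing Implicit Defensive.

(** * Integration on bounded intervals *)

Section affine.
Context {R : realType}.
Notation mu := (@lebesgue_measure R).
Implicit Types (f : R -> R) (a b : R).

Let affine a b (s : R) : measurableTypeR R := a + (b - a) * s.

Lemma measurable_affine a b : measurable_fun [set: measurableTypeR R] (affine a b).
Proof.
apply: continuous_measurable_fun => s; apply: cvgD; first exact: cvg_cst.
by apply: cvgM; [exact: cvg_cst|exact: cvg_id].
Qed.

Let affine_measure a b : {measure set (measurableTypeR R) -> \bar R} :=
  measure_function_pushforward__canonical__measure_function_Measure mu (measurable_affine a b).

(** Lebesgue measure is determined by its values on half-open intervals, and there the rescaled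
    pushforward returns the length. This is the substitution that later moves every singular
    integral to []0, 1[]. *)
Lemma lebesgue_measure_affine a b (ba : 0 < b - a) (A : set R) : measurable A ->
  mu A = mscale (NngNum (ltW ba)) (affine_measure a b) A.
Proof.
apply: lebesgue_measure_unique => _ [[u v] _ <-] /=.
rewrite /mscale /= /pushforward.
have -> : affine a b @^-1` `]u, v] = `](u - a) / (b - a), (v - a) / (b - a)].
  by apply/seteqP; split => s /=; rewrite !in_itv/= /affine ltr_pdivrMr// ler_pdivlMr//; rewrite (mulrC s) ltrBlDl lerBrDl.
rewrite !lebesgue_measure_itv/= !lte_fin ltr_pM2r ?invr_gt0// ltrD2r.
case: ifPn => // uv; last by rewrite mule0.
by rewrite -EFinB -EFinM; congr EFin; field; rewrite gt_eqF.
Qed.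

Lemma ge0_integral_affine f a b : a < b -> measurable_fun `]a, b[ f ->
  (forall x, a < x < b -> 0 <= f x) ->
  (\int[mu]_(x in `]a, b[) (f x)%:E =
   (b - a)%:E * \int[mu]_(x in `]0%R, 1%R[) (f (a + (b - a) * x))%:E)%E.
Proof.
move=> ab mf f0.
have ba : 0 < b - a by rewrite subr_gt0.
rewrite (@eq_measure_integral _ _ _ _ (mscale (NngNum (ltW ba)) (affine_measure a b))); last first.
  by move=> A mA _; exact: lebesgue_measure_affine.
rewrite ge0_integral_mscale//=; last exact/measurable_EFinP.
rewrite (@ge0_integral_pushforward _ _ _ _ _ _ (measurable_affine a b))//=; last 2 first.
- exact/measurable_EFinP.
- by move=> x; rewrite inE /= in_itv/= lee_fin; exact: f0.
congr (_ * _)%E.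
have -> // : affine a b @^-1` `]a, b[ = `]0, 1[.
apply/seteqP; split => s /=; rewrite !in_itv/= /affine ltrDl pmulr_rgt0// -ltrBrDl gtr_pMr//.
Qed.

Lemma integrable_affine f a b : a < b -> measurable_fun `]a, b[ f ->
  mu.-integrable `]0, 1[ (EFin \o (fun x => f (a + (b - a) * x))) ->
  mu.-integrable `]a, b[ (EFin \o f).
Proof.
move=> ab mf /integrableP[_ fi]; apply/integrableP; split; first exact/measurable_EFinP.
rewrite /= (@ge0_integral_affine (fun x => `|f x|) a b)//; last exact: measurableT_comp.
by rewrite lte_mul_pinfty// lee_fin subr_ge0 ltW.
Qed.

Lemma Rintegral_affine f a b : a < b -> measurable_fun `]a, b[ f ->
  mu.-integrable `]0, 1[ (EFin \o (fun x => f (a + (b - a) * x))) ->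
  \int[mu]_(x in `]a, b[) f x = (b - a) * \int[mu]_(x in `]0, 1[) f (a + (b - a) * x).
Proof.
move=> ab mf fi; have fab := integrable_affine ab mf fi.
have ge0E (g : R -> R) : measurable_fun `]a, b[ g -> (forall x, 0 <= g x) ->
    mu.-integrable `]0, 1[ (EFin \o (fun x => g (a + (b - a) * x))) ->
    \int[mu]_(x in `]a, b[) g x =
    (b - a) * \int[mu]_(x in `]0, 1[) g (a + (b - a) * x).
  move=> mg g0 gi; rewrite /Rintegral ge0_integral_affine// fineM//.
  exact: integrable_fin_num.
have fp : mu.-integrable `]0, 1[ (EFin \o (fun x => f^\+ (a + (b - a) * x))).
  exact: (@integrable_funrpos _ _ _ mu `]0, 1[ (fun x => f (a + (b - a) * x)) (measurable_itv _) fi).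
have fn : mu.-integrable `]0, 1[ (EFin \o (fun x => f^\- (a + (b - a) * x))).
  exact: (@integrable_funrneg _ _ _ mu `]0, 1[ (fun x => f (a + (b - a) * x)) (measurable_itv _) fi).
have fE : forall x, f x = f^\+ x - f^\- x by move=> x; rewrite -[in LHS](funrposBneg f).
transitivity (\int[mu]_(x in `]a, b[) (f^\+ x - f^\- x)).
  by apply: eq_Rintegral => x _; exact: fE.
rewrite RintegralB//=; last 2 first.
- exact: integrable_funrpos.
- exact: integrable_funrneg.
rewrite !ge0E//; last 2 first.
- exact: measurable_funrneg.
- exact: measurable_funrpos.
rewrite -mulrBr -RintegralB//.
by congr (_ * _); apply: eq_Rintegral => x _; rewrite -fE.
Qed.

End affine.

Section powers.
Context {R : realType}.
Notation mu := (@lebesgue_measure R).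
Implicit Types (f F : R -> R) (a b q x t s : R).

(** Meant for [f] unbounded at an endpoint. On compact subintervals the integral is a difference of
    values of [F], at most [F b - F a] since [F] increases; monotone convergence carries this bound
    to the open interval. *)
Lemma integrable_primitive f F a b : a < b -> {in `]a, b[, continuous f} ->
  (forall x, a < x < b -> 0 <= f x) ->
  derivable_oo_LRcontinuous F a b -> {in `]a, b[, F^`() =1 f} ->
  mu.-integrable `]a, b[ (EFin \o f).
Proof.
move=> ab cf f0 dF Ff.
(* With [n.+3] the margin is at most a third of the length, so each compact interval [I n] is
   nondegenerate. *)
pose d (n : nat) := (b - a) / n.+3%:R.
have d0 n : 0 < d n by rewrite divr_gt0// subr_gt0.
have dle n m : (n <= m)%N -> d m <= d n.
  by move=> nm; rewrite ler_pM2l ?subr_gt0// lef_pV2 ?posrE// ler_nat !ltnS.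
have dab n : a + d n < b - d n.
  have : d n <= (b - a) / 3 by exact: (dle 0%N n).
  by lra.
pose I n : set R := `[a + d n, b - d n].
have Iab n : I n `<=` `]a, b[.
  by move=> x; rewrite /I /= !in_itv/= => /andP[x1 x2]; have := d0 n; lra.
have -> : (`]a, b[ : set R) = \bigcup_n I n.
  apply/seteqP; split => [x|x [n _]]; last exact: Iab.
  rewrite /= in_itv/= => /andP[ax xb].
  pose e := Num.min (x - a) (b - x).
  have e0 : 0 < e by rewrite lt_min !subr_gt0 ax.
  have [n _ nP] : \forall n \near \oo, d n < e.
    have /cvgrPdist_lt/(_ _ e0) : d n @[n --> \oo] --> (0 : R).
      rewrite -(mulr0 (b - a)); apply: cvgM; first exact: cvg_cst.
      have := @cvg_harmonic R; rewrite -(cvg_shiftn 2).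
      by apply: cvg_trans; apply: near_eq_cvg; near=> n; rewrite /= addn2.
    by apply: filterS => n; rewrite sub0r normrN gtr0_norm.
  exists n => //; rewrite /I /= in_itv/=; have := nP n (leqnn n).
  by rewrite /e /= lt_min; lra.
have mf n : measurable_fun (I n) f.
  apply: (measurable_funS _ (@Iab n)) => //.
  exact: open_continuous_measurable_fun.
apply/integrableP; split.
  by apply/measurable_EFinP/measurable_fun_bigcup => // n; exact: measurable_itv.
have IF n : (\int[mu]_(x in I n) `|(f x)%:E| = (F (b - d n))%:E - (F (a + d n))%:E)%E.
  rewrite -(@continuous_FTC2 _ f)//.
  - apply: eq_integral => x; rewrite inE => /Iab; rewrite /= in_itv/= => xab.
    by rewrite ger0_norm// f0.
  - apply: (continuous_subspaceW (@Iab n)).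
    by rewrite continuous_open_subspace.
  - apply: (derivable_oo_continuousW (dab n) _ dF) => x xI.
    by apply: subset_itv_oo_cc; exact: (@Iab n).
  - by move=> x xI; apply: Ff; rewrite inE/=; move: xI; rewrite !in_itv/=; have := d0 n; lra.
have Fincr : {in `[a, b]%R &, {homo F : x y / x <= y >-> x <= y}}.
  apply: ger0_derive1_le_cc.
  - by case: dF.
  - by move=> x xab; rewrite Ff ?f0// ?inE.
  - exact: derivable_oo_LRcontinuous_within.
have cvI : (\int[mu]_(x in I n) `|(f x)%:E|)%E @[n --> \oo] -->
    (\int[mu]_(x in \bigcup_n I n) `|(f x)%:E|)%E.
  apply: ge0_nondecreasing_set_cvg_integral => //.
  - move=> m n mn; apply/subsetPset => x; rewrite /I /= !in_itv/= => /andP[x1 x2].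
    by have := dle _ _ mn; lra.
  - by move=> n; exact: measurable_itv.
  - move=> n; apply/(@measurable_EFinP _ _ _ _ (fun x => `|f x|)).
    exact: (measurableT_comp (@normr_measurable _ _) (mf n)).
rewrite -(cvg_lim _ cvI)//; apply: (@le_lt_trans _ _ (F b - F a)%:E); last exact: ltry.
apply: lime_le; first by apply/cvg_ex; eexists; exact: cvI.
apply: nearW => n; rewrite IF -EFinB lee_fin.
have := d0 n; have := dab n => dn0 dn1; apply: lerB; apply: Fincr.
all: rewrite ?in_itv/=; lra.
Unshelve. all: by end_near. Qed.

Lemma continuous_powR (q x : R) : 0 < x -> {for x, continuous (fun t : R => t `^ q)}.
Proof.
move=> x0; have [+ _] := @is_derive1_powR R q x x0.
by move/derivable1_diffP/differentiable_continuous.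
Qed.

(** [powR] has a junk value at negative bases. Truncating the argument makes the functions built
    from it continuous on the whole line, the form in which later lemmas take their data. *)
Lemma continuous_powR_max (q : R) : 0 < q ->
  continuous (fun t : R => (Num.max t 0) `^ q).
Proof.
move=> q0 t; have [t0|t0|t0] := ltgtP t 0.
- have zq (s : R) : s < 0 -> Num.max s 0 `^ q = 0 :> R.
    by move=> s0; rewrite max_r ?powR0 ?gt_eqF// ltW.
  rewrite /continuous_at zq//; apply: cvg_near_cst; near=> s; apply: zq.
  by near: s; exact: lt_nbhsl.
- apply: (@cvg_trans _ ((fun t : R => t `^ q) s @[s --> t])).
    apply: near_eq_cvg; near=> s => /=.
    have s0 : 0 < s by near: s; exact: lt_nbhsr.
    by rewrite max_l// ltW.
  by rewrite /continuous_at max_l ?ltW//; exact: continuous_powR.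
- rewrite /continuous_at t0 maxxx powR0 ?gt_eqF//; apply/cvgrPdist_lt => e e0.
  have /cvgrPdist_lt/(_ _ e0)[d /= d0 dP] := powR_cvg0 q0.
  exists d => //= s /=; rewrite sub0r normrN => sd; rewrite sub0r normrN.
  have [s0|s0] := ltP 0 s.
    by have := dP s; rewrite /= !sub0r !normrN; apply.
  by rewrite powR0 ?gt_eqF// normr0.
Unshelve. all: by end_near. Qed.

Lemma integrable_powR01 q : 0 < q ->
  mu.-integrable `]0, 1[ (EFin \o (fun x => x `^ (q - 1))).
Proof.
move=> q0.
have dF (x : R) : 0 < x -> is_derive x 1 (fun x : R => q^-1 * x `^ q) (x `^ (q - 1)).
  move=> x0; have := @is_derive1_powR _ q _ x0 => dp.
  have dz := @is_deriveZ R R R _ q^-1 x 1 _ dp.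
  apply: (is_derive_eq dz).
  by rewrite /GRing.scale/= mulrA mulVf ?mul1r// gt_eqF.
apply: (@integrable_primitive _ (fun x : R => q^-1 * x `^ q)) => //.
- by move=> x; rewrite inE/= in_itv/= => /andP[x0 _]; exact: continuous_powR.
- by move=> x _; exact: powR_ge0.
- split.
  + by move=> x; rewrite in_itv/= => /andP[x0 _]; have [] := dF x x0.
  + by rewrite powR0 ?gt_eqF//; apply: cvgM; [exact: cvg_cst|exact: powR_cvg0].
  + apply: cvgM; first exact: cvg_cst.
    by apply: cvg_at_left_filter; exact: continuous_powR.
- move=> x; rewrite inE/= in_itv/= => /andP[x0 _].
  by rewrite derive1E; have [_ ->] := dF x x0.
Qed.

Lemma integrable_powRB01 q : 0 < q ->
  mu.-integrable `]0, 1[ (EFin \o (fun x => (1 - x) `^ (q - 1))).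
Proof.
move=> q0.
have dF (x : R) : x < 1 -> is_derive x 1 (fun x : R => - (q^-1 * (1 - x) `^ q)) ((1 - x) `^ (q - 1)).
  move=> x1; have x1' : 0 < 1 - x by rewrite subr_gt0.
  have dp := @is_derive1_powR _ q _ x1'.
  have db : is_derive x 1 (fun x : R => 1 - x) (- 1).
    have h := @is_deriveB R R R (cst 1) id x 1 0 1 (is_derive_cst _ _ _) (is_derive_id _ _).
    by apply: (is_derive_eq h); rewrite sub0r.
  have dc := @is_derive1_comp R (fun t : R => t `^ q) (fun x : R => 1 - x) x _ _ dp db.
  have dz := @is_deriveN R R R _ x 1 _ (@is_deriveZ R R R _ q^-1 x 1 _ dc).
  apply: (is_derive_eq dz).
  rewrite /GRing.scale/=; field; by rewrite gt_eqF.
apply: (@integrable_primitive _ (fun x : R => - (q^-1 * (1 - x) `^ q))) => //.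
- move=> x; rewrite inE/= in_itv/= => /andP[_ x1].
  apply: (@continuous_comp _ _ _ (fun x => 1 - x) (fun t : R => t `^ (q - 1))).
    by apply: continuousB; [exact: cvg_cst|exact: cvg_id].
  by apply: continuous_powR; rewrite subr_gt0.
- by move=> x _; exact: powR_ge0.
- split.
  + by move=> x; rewrite in_itv/= => /andP[_ x1]; have [] := dF x x1.
  + apply: cvg_at_right_filter.
    by have [/derivable1_diffP/differentiable_continuous] := dF 0 ltr01.
  + rewrite subrr powR0 ?gt_eqF// mulr0; apply: cvgN; rewrite -(mulr0 q^-1); apply: cvgM; first exact: cvg_cst.
    have <- : (Num.max (1 - (1 : R)) 0) `^ q = 0 by rewrite subrr maxxx powR0// gt_eqF.
    apply: (@cvg_trans _ ((Num.max (1 - x) 0) `^ q @[x --> (1 : R)^'-])).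
      by apply: near_eq_cvg; near=> x => /=; rewrite max_l// subr_ge0.
    apply: cvg_at_left_filter.
    apply: (@continuous_comp _ _ _ (fun x : R => 1 - x) (fun t => (Num.max t 0) `^ q)).
      by apply: continuousB; [exact: cvg_cst|exact: cvg_id].
    exact: continuous_powR_max.
- move=> x; rewrite inE/= in_itv/= => /andP[_ x1].
  by rewrite derive1E; have [_ ->] := dF x x1.
Unshelve. all: by end_near. Qed.

End powers.

(** * Weighted averages *)

Section real_integrable.
Context d (T : measurableType d) (R : realType) (nu : {measure set T -> \bar R}).
Implicit Types (D : set T) (f g : T -> R).

Lemma le_integrableR D f g : measurable D -> measurable_fun D f ->
  (forall x, D x -> `|f x| <= g x) -> nu.-integrable D (EFin \o g) ->
  nu.-integrable D (EFin \o f).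
Proof.
move=> mD mf fg; apply: le_integrable => //; first exact/measurable_EFinP.
by move=> x Dx; rewrite lee_fin (le_trans (fg x Dx))// ler_norm.
Qed.

Lemma integrableDR D f g : measurable D ->
  nu.-integrable D (EFin \o f) -> nu.-integrable D (EFin \o g) ->
  nu.-integrable D (EFin \o (fun x => f x + g x)).
Proof. by move=> mD fi gi; exact: (integrableD mD fi gi). Qed.

Lemma integrableZR D f (k : R) : measurable D ->
  nu.-integrable D (EFin \o f) -> nu.-integrable D (EFin \o (fun x => k * f x)).
Proof. by move=> mD fi; exact: (integrableZl mD k fi). Qed.

End real_integrable.

Section weights.
Context {R : realType}.
Notation mu := (@lebesgue_measure R).
Implicit Types (f F w n : R -> R) (a b c e p q x t s z al T : R).

Lemma integrable_within_oo f a b : {within `[a, b], continuous f} ->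
  mu.-integrable `]a, b[ (EFin \o f).
Proof.
move=> cf; apply: (@integrableS _ _ _ mu `[a, b]) => //.
  exact: subset_itv_oo_cc.
exact: (continuous_compact_integrable (@segment_compact _ _ _) cf).
Qed.

Lemma powR_ge1 x q : 0 < x <= 1 -> q <= 0 -> 1 <= x `^ q.
Proof. by move=> x01 q0; rewrite -(powRr0 x); exact: ger_powR. Qed.

Lemma measurable_powRB D q : measurable_fun D (fun x : R => (1 - x) `^ q).
Proof.
apply: measurable_funTS.
apply: (@measurableT_comp _ _ _ _ _ _ (fun x : R => x `^ q) _ (fun x : R => 1 - x)) => //.
exact: measurable_funB.
Qed.

(** The integrand of Euler's Beta function. It appears when a convolution of two powers over []0,
    t[] is rescaled to []0, 1[]. *)
Definition beta_weight p q s : R := (1 - s) `^ (p - 1) * s `^ (q - 1).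

Lemma beta_weight_ge0 p q s : 0 <= beta_weight p q s.
Proof. by rewrite mulr_ge0 ?powR_ge0. Qed.

Lemma measurable_beta_weight D p q : measurable_fun D (beta_weight p q).
Proof.
apply: measurable_funM; first exact: measurable_powRB.
by apply: measurable_funTS; exact: measurable_powR.
Qed.

(** One of [s] and [1 - s] is at least 1/2, and the corresponding factor is then at most 2. So the
    product is dominated by twice the sum of two powers, each singular at one end only. *)
Lemma integrable_beta_weight p q : 0 < p <= 1 -> 0 < q <= 1 ->
  mu.-integrable `]0, 1[ (EFin \o beta_weight p q).
Proof.
move=> /andP[p0 p1] /andP[q0 q1].
have powR_le2 z x : 0 <= z <= 1 -> 2^-1 <= x <= 1 -> x `^ (z - 1) <= 2.
  move=> z01 /andP[x2 x1]; have x0 : 0 < x by apply: lt_le_trans x2; rewrite invr_gt0.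
  rewrite -opprB powRN -[leRHS]invrK lef_pV2 ?posrE ?powR_gt0//.
  apply: (le_trans x2); apply: ger1_powR; lra.
apply: (@le_integrableR _ _ _ mu _ _ (fun s : R => 2 * ((1 - s) `^ (p - 1) + s `^ (q - 1)))) => //.
- exact: measurable_beta_weight.
- move=> s; rewrite /= in_itv/= => /andP[s0 s1].
  rewrite ger0_norm ?beta_weight_ge0// /beta_weight mulrDr; have [s2|s2] := leP 2^-1 s.
    rewrite (le_trans (ler_wpM2l (powR_ge0 _ _) (powR_le2 q s _ _)))//; [lra|lra|].
    by rewrite mulrC lerDl mulr_ge0// powR_ge0.
  rewrite (le_trans (ler_wpM2r (powR_ge0 _ _) (powR_le2 p (1 - s) _ _)))//; [lra|lra|].
  by rewrite lerDr mulr_ge0// powR_ge0.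
- apply: integrableZR => //; apply: integrableDR => //.
  - exact: integrable_powRB01.
  - exact: integrable_powR01.
Qed.

Lemma Rintegral01_ge1 f : mu.-integrable `]0, 1[ (EFin \o f) ->
  (forall s, 0 < s < 1 -> 1 <= f s) -> 1 <= \int[mu]_(s in `]0, 1[) f s.
Proof.
move=> fi f1.
have I1 : \int[mu]_(s in `]0, 1[) (1 : R) = 1.
  rewrite Rintegral_cst//; transitivity (1 * fine (mu (`]0%R, 1%R[ : set R))) => //.
  by rewrite lebesgue_measure_itv/= lte_fin ltr01 -EFinB/= subr0 mulr1.
apply: (@le_trans _ _ (\int[mu]_(s in `]0, 1[) (1 : R))); first by rewrite I1.
apply: le_Rintegral => //.
  by apply: integrable_within_oo => s; exact: cvg_cst.
Qed.

Lemma beta_weight_ge1 p q s : p <= 1 -> q <= 1 -> 0 < s < 1 -> 1 <= beta_weight p q s.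
Proof.
move=> p1 q1 s01; rewrite -[leLHS]mulr1 ler_pM//; apply: powR_ge1; lra.
Qed.

(** A divergent integral would have real value 0, so integrability is proved first: the integrand is
    below a power on []0, 1[] and below the exponential density from 1 on. Positivity then comes
    from []0, 1[] alone, where the integrand is at least [expR (- 1)]. *)
Lemma Gamma_gt0 z : 0 < z <= 1 -> 0 < Gamma z.
Proof.
move=> /andP[z0 z1]; pose g u : R := u `^ (z - 1) * expR (- u).
have g0 u : 0 <= g u by rewrite mulr_ge0 ?powR_ge0 ?expR_ge0.
have mg (D : set (measurableTypeR R)) : measurable_fun D g.
  apply: measurable_funM; first by apply: measurable_funTS; exact: measurable_powR.
  by apply: measurable_funTS; apply: measurableT_comp => //.
have gi01 : mu.-integrable `]0, 1[ (EFin \o g).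
  apply: (@le_integrableR _ _ _ mu _ _ (fun u : R => u `^ (z - 1))) => //.
  - move=> u; rewrite /= in_itv/= => /andP[u0 u1].
    by rewrite ger0_norm// ler_piMr ?powR_ge0// -expR0 ler_expR oppr_le0 ltW.
  - exact: integrable_powR01.
have gi : mu.-integrable `]0, +oo[ (EFin \o g).
  pose h1 := (fun u : R => u `^ (z - 1)) \_ `]0, 1[.
  have h10 u : 0 <= h1 u by apply: restrict_ge0 => {}u _; exact: powR_ge0.
  have h1i : mu.-integrable setT (EFin \o h1).
    rewrite /h1 -restrict_EFin; apply/(@integrable_mkcond _ _ _ mu `]0, 1[) => //.
    exact: integrable_powR01.
  have e0 u := exponential_pdf_ge0 (@ler01 R) u.
  apply: (@le_integrableR _ _ _ mu _ _ (fun u : R => h1 u + exponential_pdf 1 u)) => //; last first.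
    apply: (@integrableS _ _ _ mu setT) => //.
    by apply: integrableDR => //; exact: integrable_exponential_pdf.
  move=> u; rewrite /= in_itv/= andbT => u0; rewrite ger0_norm//.
  have [u1|u1] := ltP u 1.
    have -> : h1 u = u `^ (z - 1) by rewrite /h1 patchE mem_set//= in_itv/= u0.
    rewrite -[leLHS]addr0 lerD// ler_piMr ?powR_ge0// -[leRHS]expR0 ler_expR.
    by rewrite oppr_le0 ltW.
  apply: (@le_trans _ _ (expR (- u))).
    rewrite /g ler_piMl ?expR_ge0//.
    by rewrite -[leRHS](powRr0 u) ler_powR// subr_le0.
  by rewrite exponential_pdfE ?(ltW u0)// mul1r mulN1r lerDr.
have gfin : (\int[mu]_(u in `]0%R, +oo[) (g u)%:E)%E \is a fin_num by exact: integrable_fin_num.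
apply: (@lt_le_trans _ _ (\int[mu]_(u in `]0, 1[) g u)).
  apply: (@lt_le_trans _ _ (expR (- 1) * 1)); first by rewrite mulr1 expR_gt0.
  rewrite -(@ler_pM2l _ (expR 1)) ?expR_gt0// mulr1 -expRD subrr expR0 -RintegralZl//.
  apply: Rintegral01_ge1; first exact: integrableZR.
  move=> u /andP[u0 u1]; rewrite mulrCA -expRD -[leLHS]mulr1 ler_pM//.
    by apply: powR_ge1; lra.
  by rewrite -[leLHS]expR0 ler_expR; lra.
apply: fine_le; [exact: integrable_fin_num|exact: gfin|].
apply: ge0_subset_integral => //.
- exact/measurable_EFinP.
- by move=> u _; rewrite lee_fin.
- by move=> u; rewrite /= !in_itv/= => /andP[->].
Qed.

(** A weighted average of [n] over the interval from 0 to [t]. After rescaling, [t] occurs only in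
    the argument of [n], so the singular weight is fixed and continuity in [t] follows by
    domination. *)
Definition avg w n t : R := \int[mu]_(s in `]0, 1[) (w s * n (t * s)).

Lemma continuous_bounded n a b : continuous n -> exists M : R, forall x, a <= x <= b -> `|n x| <= M.
Proof.
move=> cn; have [ab|ba] := leP a b; last by exists 0 => x; lra.
have [|c _ cP] := @EVT_max R (fun x => `|n x|) a b ab.
  by apply: continuous_subspaceT => x; apply: continuous_comp; [exact: cn|exact: norm_continuous].
by exists `|n c| => x xab; apply: cP; rewrite in_itv.
Qed.

Lemma measurable_avg (D : set (measurableTypeR R)) w n t : measurable_fun D w -> continuous n ->
  measurable_fun D (fun s : R => w s * n (t * s)).
Proof.
move=> mw cn; apply: measurable_funM => //; apply: measurable_funTS; apply: continuous_measurable_fun.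
move=> s; apply: (@continuous_comp _ _ _ (fun s => t * s) n); last exact: cn.
exact: mulrl_continuous.
Qed.

Lemma integrable_avg w n t : mu.-integrable `]0, 1[ (EFin \o w) -> continuous n ->
  mu.-integrable `]0, 1[ (EFin \o (fun s => w s * n (t * s))).
Proof.
move=> wi cn.
have mw : measurable_fun (`]0%R, 1%R[ : set (measurableTypeR R)) w.
  by apply/measurable_EFinP; exact: (measurable_int _ wi).
have [M MP] := continuous_bounded (- `|t|) `|t| cn.
apply: (@le_integrableR _ _ _ mu _ _ (fun s : R => M * `|w s|)) => //.
- exact: measurable_avg.
- move=> s; rewrite /= in_itv/= => /andP[s0 s1]; rewrite normrM mulrC ler_wpM2r//.
  apply: MP; rewrite -ler_norml normrM ler_piMr// gtr0_norm// ltW//.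
- by apply: integrableZR => //; exact: integrable_norm.
Qed.

Lemma continuous_avg w n : mu.-integrable `]0, 1[ (EFin \o w) -> continuous n ->
  continuous (avg w n).
Proof.
move=> wi cn t.
pose T := `|t| + 1.
have [M MP] := continuous_bounded (- T) T cn.
have tT : t \in (`]- T, T[ : set R).
  by rewrite inE/= in_itv/= -ltr_norml /T ltrDl.
apply: (@continuity_under_integral R _ _ mu (fun t s => w s * n (t * s)) `]0, 1[ _ (- T) T _ _ (fun s => M * `|w s|)) => //.
- by move=> u _; exact: integrable_avg.
- apply: aeW => s _ u _; apply: continuousM; first exact: cvg_cst.
  by apply: (@continuous_comp _ _ _ (fun u : R => u * (s : R)) n); [exact: mulrr_continuous|exact: cn].
- by apply: integrableZR => //; exact: integrable_norm.
- move=> u; rewrite /= in_itv/= -ltr_norml => uT; apply: aeW => s; rewrite /= in_itv/= => /andP[s0 s1].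
  rewrite normrM mulrC ler_wpM2r//; apply: MP; rewrite -ler_norml normrM.
  rewrite (gtr0_norm s0) (le_trans _ (ltW uT))// ler_piMr// ltW//.
Qed.

(* The factor [expR (- l * t * (1 - s))] is the ratio of the weights
   [expR (l * t * s)] and [expR (l * t)] of an exponentially weighted supremum
   norm. *)
Lemma avg_contraction w al T e : mu.-integrable `]0, 1[ (EFin \o w) ->
  (forall s, 0 <= w s) -> 0 < al -> 0 < e ->
  exists2 l : R, 0 <= l & forall t, 0 <= t <= T ->
    t `^ al * (\int[mu]_(s in `]0, 1[) (w s * expR (l * t * s))) <= e * expR (l * t).
Proof.
move=> wi w0 al0 e0.
pose W := \int[mu]_(s in `]0, 1[) w s.
have W0 : 0 <= W by apply: Rintegral_ge0.
pose ew (c : R) s := w s * expR (- (c * (1 - s))).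
have mw : measurable_fun (`]0%R, 1%R[ : set (measurableTypeR R)) w.
  by apply/measurable_EFinP; exact: (measurable_int _ wi).
have mew c : measurable_fun (`]0%R, 1%R[ : set (measurableTypeR R)) (ew c).
  apply: measurable_funM => //; apply: measurable_funTS; apply: continuous_measurable_fun.
  move=> s; apply: (@continuous_comp _ _ _ (fun s : R => - (c * (1 - s))) expR); last exact: continuous_expR.
  apply: continuousN; apply: continuousM; first exact: cvg_cst.
  by apply: continuousB; [exact: cvg_cst|exact: cvg_id].
have ewle c s : 0 <= c -> 0 < s < 1 -> ew c s <= w s.
  move=> c0 /andP[s0 s1]; rewrite ler_piMr// -[leRHS]expR0 ler_expR oppr_le0 mulr_ge0//.
  by rewrite subr_ge0 ltW.
have ew0 c s : 0 <= ew c s by rewrite mulr_ge0// expR_ge0.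
have ewi c : 0 <= c -> mu.-integrable `]0, 1[ (EFin \o ew c).
  move=> c0; apply: (@le_integrableR _ _ _ mu _ _ w) => // s; rewrite /= in_itv/= => s01.
  by rewrite ger0_norm// ewle.
pose I c := \int[mu]_(s in `]0, 1[) ew c s.
have Ile c c' : 0 <= c -> c <= c' -> I c' <= I c.
  move=> c0 cc'; apply: le_Rintegral => //; [apply: ewi; lra|exact: ewi|].
  move=> s; rewrite /= in_itv/= => /andP[s0 s1]; rewrite ler_wpM2l// ler_expR lerN2 ler_wpM2r// subr_ge0 ltW//.
have IW c : 0 <= c -> I c <= W.
  move=> c0; apply: le_Rintegral => //; first exact: ewi.
  by move=> s; rewrite /= in_itv/=; exact: ewle.
(* For [s < 1] the exponential factor tends to 0 as [c] grows, so dominated convergence with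
   majorant [w] applies. *)
have I0 e' : 0 < e' -> exists2 c, 0 <= c & I c <= e'.
  move=> e'0.
  have cv : (\int[mu]_(s in `]0%R, 1%R[) (ew k%:R s)%:E)%E @[k --> \oo] -->
      (0%R)%:E.
    have -> : (0%R)%:E = (\int[mu]_(s in `]0%R, 1%R[) (cst 0%R s)%:E)%E by rewrite integral0_eq.
    apply: (@dominated_cvg _ _ _ mu _ _ (fun k s => (ew k%:R s)%:E) _ (EFin \o w)) => //.
    - by move=> k; exact/measurable_EFinP.
    - move=> s; rewrite /= in_itv/= => /andP[s0 s1]; apply: cvg_EFin; first exact: nearW.
      rewrite -[X in _ --> X](mulr0 (w s)); apply: cvgM; first exact: cvg_cst.
      apply: (@cvg_comp _ _ _ (fun k : nat => k%:R * (1 - s)) (fun x => expR (- x)) _ (pinfty_nbhs R)); last exact: cvgr_expR.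
      apply/cvgryPge => A; have /cvgryPge/(_ (A / (1 - s))) := @cvgr_idn R.
      by apply: filterS => k; rewrite ler_pdivrMr// subr_gt0.
    - by move=> k s; rewrite /= in_itv/= => s01; rewrite lee_fin ger0_norm// ewle.
  have : I k%:R @[k --> \oo] --> (0 : R) by exact: (fine_cvg cv).
  move/cvgrPdist_lt => /(_ _ e'0)[k _ kP]; exists k%:R => //.
  have := kP k (leqnn k); rewrite /= sub0r normrN => /ltW; apply: le_trans.
  exact: ler_norm.
have [T0|T0] := ltP T 0; first by exists 0 => // t; lra.
(* Two regimes: up to time [d] the factor [t ^ al] is small enough by itself; beyond [d], the choice
   [l = c / d] gives [l * t >= c], and the integral [I] is small. *)
pose d := (e / (W + 1)) `^ (al^-1).
have eW : 0 < e / (W + 1) by rewrite divr_gt0// ltr_wpDl.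
have d0 : 0 < d by rewrite powR_gt0.
have dal : d `^ al = e / (W + 1) by rewrite -powRrM mulVf ?gt_eqF// powRr1// ltW.
have [c c0 cP] := I0 (e / (T `^ al + 1)) (divr_gt0 e0 (ltr_wpDl (powR_ge0 _ _) ltr01)).
exists (c / d); first by rewrite divr_ge0// ltW.
move=> t /andP[t0 tT].
have -> : \int[mu]_(s in `]0, 1[) (w s * expR (c / d * t * s)) = expR (c / d * t) * I (c / d * t).
  have c1 : 0 <= c / d * t by rewrite mulr_ge0// divr_ge0// ltW.
  rewrite /I -RintegralZl//; last exact: ewi.
  apply: eq_Rintegral => s _; rewrite /ew mulrCA -expRD; congr (_ * expR _); ring.
rewrite mulrCA mulrC ler_wpM2r ?expR_ge0//.
have [td|dt] := leP t d.
  apply: (@le_trans _ _ (e / (W + 1) * W)).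
    apply: ler_pM; [exact: powR_ge0|exact: Rintegral_ge0| |].
      by rewrite -dal ge0_ler_powR ?nnegrE// ltW.
    by apply: IW; rewrite mulr_ge0// divr_ge0// ltW.
  rewrite mulrAC ler_pdivrMr; last by rewrite ltr_wpDl.
  by rewrite ler_wpM2l ?lerDl// ltW.
apply: (@le_trans _ _ (T `^ al * (e / (T `^ al + 1)))).
  apply: ler_pM; [exact: powR_ge0|exact: Rintegral_ge0| |].
    by rewrite ge0_ler_powR ?nnegrE// ltW.
  apply: (le_trans _ cP); apply: Ile => //.
  rewrite -mulrA ler_peMr// ler_pdivlMl// mulr1 ltW//.
rewrite mulrCA ger_pMr// ler_pdivrMr ?mul1r ?lerDl//.
by rewrite ltr_wpDl// powR_ge0.
Qed.

End weights.

(** * A Volterra equation with a weakly singular kernel *)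

Section volterra.
Context {R : realType}.
Notation mu := (@lebesgue_measure R).
Implicit Types (f w n v : R -> R) (a b c e l p q x t s z al T A B K M D : R).

Lemma integrable_avg_expR w c : mu.-integrable `]0, 1[ (EFin \o w) ->
  mu.-integrable `]0, 1[ (EFin \o (fun s => w s * expR (c * s))).
Proof. by move=> wi; apply: integrable_avg => //; exact: continuous_expR. Qed.

Lemma avg_dist_le w n n' t B l : mu.-integrable `]0, 1[ (EFin \o w) ->
  (forall s, 0 <= w s) -> continuous n -> continuous n' ->
  (forall s, 0 < s < 1 -> `|n (t * s) - n' (t * s)| <= B * expR (l * t * s)) ->
  `|avg w n t - avg w n' t| <= B * \int[mu]_(s in `]0, 1[) (w s * expR (l * t * s)).
Proof.
move=> wi w0 cn cn' nn'; rewrite /avg -RintegralB//; [|exact: integrable_avg|exact: integrable_avg].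
have wei := integrable_avg_expR (l * t) wi.
have di : mu.-integrable `]0, 1[ (EFin \o (fun s => w s * n (t * s) - w s * n' (t * s))).
  have := @integrable_avg R w (fun x => n x - n' x) t wi.
  rewrite (_ : (fun s => w s * (n (t * s) - n' (t * s))) = (fun s => w s * n (t * s) - w s * n' (t * s))); last first.
    by apply/funext => s; rewrite mulrBr.
  by apply=> x; apply: continuousB; [exact: cn|exact: cn'].
apply: (le_trans (le_normr_Rintegral _ di)) => //.
rewrite -RintegralZl//; apply: le_Rintegral => //.
- exact: integrable_norm.
- exact: integrableZR.
- move=> s; rewrite /= in_itv/= => s01; rewrite -mulrBr normrM (ger0_norm (w0 s)) mulrCA.
  by apply: ler_wpM2l => //; exact: nn'.
Qed.

Lemma cvg_geometric_half c : c * 2^-1 ^+ k @[k --> \oo] --> (0 : R).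
Proof.
rewrite -[X in _ --> X](mulr0 c); apply: cvgM; first exact: cvg_cst.
by apply: cvg_expr; rewrite gtr0_norm ?invr_gt0// invf_lt1// ltr1n.
Qed.

Lemma geometric_lt c e : 0 < e -> exists k, c * 2^-1 ^+ k < e.
Proof.
move=> e0; have /cvgrPdist_lt/(_ _ e0)[k _ kP] := cvg_geometric_half c.
exists k; have := kP k (leqnn k); rewrite /= sub0r normrN; apply: le_lt_trans.
exact: ler_norm.
Qed.

Lemma geometric_le0 x c : (forall k, `|x| <= c * 2^-1 ^+ k) -> x = 0.
Proof.
move=> xc; apply/eqP; rewrite -normr_le0 leNgt; apply/negP => x0.
have [k kP] := geometric_lt c x0.
by have := le_lt_trans (xc k) kP; rewrite ltxx.
Qed.

(** The rate is uniform only on bounded intervals, with a constant depending on [T]. That suffices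
    for a continuous limit, and the truncation hypothesis takes care of negative times. *)
Lemma geometric_limit (u : nat -> R -> R) :
  (forall k, continuous (u k)) -> (forall k t, u k t = u k (Num.max t 0)) ->
  (forall T, exists c, forall k t, 0 <= t <= T -> `|u k.+1 t - u k t| <= c * 2^-1 ^+ k) ->
  exists v, [/\ continuous v, forall t, v t = v (Num.max t 0) &
    forall T, exists2 c : R, 0 <= c & forall k t, 0 <= t <= T ->
    `|v t - u k t| <= c * 2^-1 ^+ k].
Proof.
move=> cu umax uT; pose v t := limn (fun k => u k t).
have tele T : exists2 c : R, 0 <= c & forall k m t, 0 <= t <= T -> `|u (m + k)%N t - u k t| <= c * 2^-1 ^+ k.
  have [c cP] := uT T; exists (2 * `|c|) => // k m t tT.
  (* The subtracted term, the tail of the geometric series beyond [m + k], lets the induction on [m]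
     close. *)
  suff : `|u (m + k)%N t - u k t| <= 2 * `|c| * (2^-1 ^+ k - 2^-1 ^+ (m + k)).
    move/le_trans; apply; rewrite ler_wpM2l// gerBl exprn_ge0//.
  elim: m => [|m IH]; first by rewrite add0n !subrr normr0 mulr0.
  rewrite addSn -(subrKA (u (m + k)%N t)) (le_trans (ler_normD _ _))//.
  apply: (le_trans (lerD (cP _ _ tT) IH)).
  have := ler_norm c; rewrite exprS; have : 0 <= (2^-1 : R) ^+ (m + k) by exact: exprn_ge0.
  move: (_ ^+ (m + k)) => y y0 cc; nra.
have cvu t : u k t @[k --> \oo] --> v t.
  suff : cvgn (fun k => u k t) by [].
  apply/cauchy_cvgP/cauchy_exP => e e0.
  have [c c0 cP] := tele (Num.max t 0).
  have [k kP] := geometric_lt c e0.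
  exists (u k t), k => // m /= km; apply: le_lt_trans kP.
  rewrite distrC -(subnK km) umax (umax k); apply: cP.
  by rewrite lexx andbT le_max lexx orbT.
have vT T : exists2 c : R, 0 <= c & forall k t, 0 <= t <= T -> `|v t - u k t| <= c * 2^-1 ^+ k.
  have [c c0 cP] := tele T; exists c => // k t tT.
  have cvd : `|u m t - u k t| @[m --> \oo] --> `|v t - u k t|.
    by apply: cvg_norm; apply: cvgB; [exact: cvu|exact: cvg_cst].
  rewrite -(cvg_lim _ cvd)//; apply: limr_le; first by apply/cvg_ex; eexists; exact: cvd.
  by exists k => // m /= km; rewrite -(subnK km); exact: cP.
have vmax t : v t = v (Num.max t 0) by rewrite /v; congr (limn _); apply/funext => k; exact: umax.
exists v; split => // t; apply/cvgrPdist_lt => e e0.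
have [c c0 cP] := vT (Num.max t 0 + 1).
have e3 : 0 < e / 3 by rewrite divr_gt0.
have [k kP] := geometric_lt c e3.
have vk s : s <= t + 1 -> `|v s - u k s| < e / 3.
  move=> st; apply: le_lt_trans kP; rewrite vmax umax; apply: cP.
  rewrite le_max lexx orbT/= ge_max; apply/andP; split; last by rewrite -[leLHS]addr0 lerD// le_max lexx orbT.
  by rewrite (le_trans st)// lerD2r le_max lexx.
have /cvgrPdist_lt/(_ _ e3) cuk := cu k t.
near=> s.
have st : s <= t + 1 by near: s; apply: lt_le_nbhsl => //; rewrite ltrDl.
have us : `|u k t - u k s| < e / 3 by near: s; exact: cuk.
have := vk t; have := vk _ st.
rewrite (_ : v t - v s = (v t - u k t) + (u k t - u k s) - (v s - u k s)); last by ring.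
move=> h1 h2; apply: (le_lt_trans (ler_normB _ _)).
have := ler_normD (v t - u k t) (u k t - u k s).
have : `|v t - u k t| < e / 3 by apply: h2; rewrite lerDl.
lra.
Unshelve. all: by end_near. Qed.

Context (w : R -> R) (al c0 : R) (N : (R -> R) -> R -> R).
Hypothesis wi : mu.-integrable `]0, 1[ (EFin \o w).
Hypothesis w0 : forall s, 0 <= w s.
Hypothesis al0 : 0 < al.
Hypothesis N_continuous : forall v, continuous v -> continuous (N v).
(** [A] is quantified before the weight [l], so [l] may be chosen large in terms of [A]. *)
Hypothesis N_growth : forall T, exists2 A : R, 0 <= A & forall v l M, continuous v ->
  0 <= l -> 0 <= M -> (forall s, 0 <= s <= T -> `|v s| <= M * expR (l * s)) ->
  forall s, 0 <= s <= T -> `|N v s| <= A * (1 + M * expR (l * s)).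
(** Only a local Lipschitz condition: [K] may depend on the size [M] of the arguments, but again not
    on [l]. *)
Hypothesis N_lipschitz : forall T M, exists2 K : R, 0 <= K &
  forall v v' l D, continuous v -> continuous v' -> 0 <= l -> 0 <= D ->
  (forall s, 0 <= s <= T -> `|v s| <= M) -> (forall s, 0 <= s <= T -> `|v' s| <= M) ->
  (forall s, 0 <= s <= T -> `|v s - v' s| <= D * expR (l * s)) ->
  forall s, 0 <= s <= T -> `|N v s - N v' s| <= K * D * expR (l * s).

Let Phi v t := c0 + (Num.max t 0) `^ al * avg w (N v) (Num.max t 0).

Let Phi_continuous v : continuous v -> continuous (Phi v).
Proof.
move=> cv t; apply: cvgD; first exact: cvg_cst.
apply: cvgM; first exact: continuous_powR_max.
apply: (@continuous_comp _ _ _ (fun t => Num.max t 0) (avg w (N v))).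
  by apply: continuous_max; [exact: cvg_id|exact: cvg_cst].
by apply: continuous_avg => //; exact: N_continuous.
Qed.

Let iterate k := iter k Phi (cst 0).

Let iterate_continuous k : continuous (iterate k).
Proof. by elim: k => [|k IH]; [move=> t; exact: cvg_cst|exact: Phi_continuous]. Qed.

Let avg0 t : avg w (cst 0) t = 0.
Proof.
transitivity (\int[mu]_(s in `]0, 1[) (0 : R)); last by rewrite Rintegral_cst// mul0r.
by apply: eq_Rintegral => s _; rewrite /= mulr0.
Qed.

Let iterate_bounded T : exists2 M : R, 0 <= M & forall k s, 0 <= s <= T -> `|iterate k s| <= M.
Proof.
have [A A0 AP] := N_growth T.
(* This [e] makes [A * e <= 1/2], so a weighted bound [M] on an iterate becomes [|c0| + (1 + M) / 2]
   on the next one. The value [M = 2 |c0| + 1] chosen below is the fixed point of this map. *)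
have e0 : 0 < (2 * A + 1)^-1 by rewrite invr_gt0 ltr_wpDl// mulr_ge0.
have [l l0 lP] := avg_contraction T wi w0 al0 e0.
pose M := 2 * `|c0| + 1.
have M0 : 0 <= M by rewrite addr_ge0// mulr_ge0.
suff H k s : 0 <= s <= T -> `|iterate k s| <= M * expR (l * s).
  exists (M * expR (l * T)); first by rewrite mulr_ge0// expR_ge0.
  move=> k s sT; rewrite (le_trans (H _ _ sT))// ler_wpM2l// ler_expR ler_wpM2l//.
  by case/andP: sT.
elim: k s => [|k IH] s sT; first by rewrite normr0 mulr_ge0// expR_ge0.
have /andP[s0 sT'] := sT.
have E1 : 1 <= expR (l * s) by rewrite -[leLHS]expR0 ler_expR mulr_ge0.
rewrite /= /Phi (max_idPl s0).
have c0c : continuous (cst 0 : R -> R) by move=> x; exact: cvg_cst.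
have := avg_dist_le (t := s) (B := A * (1 + M)) (l := l) wi w0 (N_continuous (@iterate_continuous k)) c0c.
rewrite avg0 subr0 => H.
have {}H : `|avg w (N (iterate k)) s| <= A * (1 + M) * \int[mu]_(s0 in `]0, 1[) (w s0 * expR (l * s * s0)).
  apply: H => x /andP[x0 x1]; rewrite /= subr0 mulrAC.
  have sx : 0 <= s * x <= T by rewrite mulr_ge0 ?(ltW x0)//= (le_trans _ sT')// ler_piMr// ltW.
  apply: (le_trans (AP _ _ _ (@iterate_continuous k) l0 M0 IH _ sx)).
  have E2 : 1 <= expR (l * (s * x)).
    by rewrite -[leLHS]expR0 ler_expR mulr_ge0//; case/andP: sx.
  rewrite -(mulrA l); move: (expR (l * (s * x))) E2 => E E2.
  have : 0 <= A * (E - 1) by rewrite mulr_ge0// subr_ge0.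
  lra.
apply: (le_trans (ler_normD _ _)); rewrite normrM (ger0_norm (powR_ge0 _ _)).
apply: (@le_trans _ _ (`|c0| + A * (1 + M) * ((2 * A + 1)^-1 * expR (l * s)))).
  rewrite lerD2l; apply: (le_trans (ler_wpM2l (powR_ge0 _ _) H)).
  rewrite mulrCA ler_wpM2l ?mulr_ge0 ?addr_ge0//; exact: lP.
have : A * (2 * A + 1)^-1 <= 2^-1.
  rewrite ler_pdivrMr; first by lra.
  by rewrite ltr_wpDl// mulr_ge0.
have -> : A * (1 + M) * ((2 * A + 1)^-1 * expR (l * s)) = (A * (2 * A + 1)^-1) * ((1 + M) * expR (l * s)) by ring.
move=> A2; apply: (@le_trans _ _ (`|c0| + 2^-1 * ((1 + M) * expR (l * s)))).
  by rewrite lerD2l ler_wpM2r// mulr_ge0 ?addr_ge0// expR_ge0.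
rewrite /M; have := normr_ge0 c0; nra.
Qed.

Let Phi_contraction T M : exists2 l : R, 0 <= l & forall v v' D, continuous v -> continuous v' -> 0 <= D ->
  (forall s, 0 <= s <= T -> `|v s| <= M) -> (forall s, 0 <= s <= T -> `|v' s| <= M) ->
  (forall s, 0 <= s <= T -> `|v s - v' s| <= D * expR (l * s)) ->
  forall s, 0 <= s <= T -> `|Phi v s - Phi v' s| <= D / 2 * expR (l * s).
Proof.
have [K K0 KP] := N_lipschitz T M.
have e0 : 0 < (2 * K + 1)^-1 by rewrite invr_gt0 ltr_wpDl// mulr_ge0.
have [l l0 lP] := avg_contraction T wi w0 al0 e0.
exists l => // v v' D cv cv' D0 vM v'M vv' s sT.
have /andP[s0 sT'] := sT.
rewrite /Phi (max_idPl s0) (_ : _ - _ = s `^ al * (avg w (N v) s - avg w (N v') s)); last by ring.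
rewrite normrM (ger0_norm (powR_ge0 _ _)).
have H : `|avg w (N v) s - avg w (N v') s| <= K * D * \int[mu]_(s0 in `]0, 1[) (w s0 * expR (l * s * s0)).
  apply: avg_dist_le => //; [exact: N_continuous|exact: N_continuous|].
  move=> x /andP[x0 x1]; rewrite -(mulrA l).
  by apply: KP => //; rewrite mulr_ge0 ?(ltW x0)//= (le_trans _ sT')// ler_piMr// ltW.
apply: (le_trans (ler_wpM2l (powR_ge0 _ _) H)); rewrite mulrCA.
apply: (le_trans (ler_wpM2l _ (lP _ sT))); first by rewrite mulr_ge0.
rewrite mulrA ler_wpM2r ?expR_ge0// mulrAC mulrC ler_wpM2l//.
rewrite ler_pdivrMr; first by lra.
by rewrite ltr_wpDl// mulr_ge0.
Qed.

Lemma volterra_solution : exists2 v, continuous v &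
  forall t, v t = c0 + (Num.max t 0) `^ al * avg w (N v) (Num.max t 0).
Proof.
have max0 (t : R) : Num.max (Num.max t 0) 0 = Num.max t 0 by rewrite -maxA maxxx.
have [||v [cv vmax vP]] := @geometric_limit iterate iterate_continuous.
- by move=> [|k] t //; rewrite /= /Phi max0.
- move=> T; have [M M0 MP] := iterate_bounded T.
  have [l l0 lP] := Phi_contraction T M.
  have H k s : 0 <= s <= T -> `|iterate k.+1 s - iterate k s| <= 2 * M * 2^-1 ^+ k * expR (l * s).
    elim: k s => [|k IH] s sT.
      rewrite expr0 mulr1 (le_trans (ler_normB _ _))//.
      rewrite (le_trans (lerD (MP 1%N _ sT) (MP 0%N _ sT)))// -mulr2n mulr_natl ler_peMr ?mulrn_wge0//.
      by rewrite -[leLHS]expR0 ler_expR mulr_ge0//; case/andP: sT.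
    rewrite exprSr mulrA; apply: (lP (iterate k.+1) (iterate k)) => //.
    - by rewrite !mulr_ge0// exprn_ge0.
    - by move=> x; exact: (MP k.+1).
    - by move=> x; exact: (MP k).
  exists (2 * M * expR (l * T)) => k t tT; rewrite (le_trans (H _ _ tT))// mulrAC ler_wpM2r ?exprn_ge0//.
  by rewrite ler_wpM2l ?mulr_ge0// ler_expR ler_wpM2l//; case/andP: tT.
exists v => // t.
rewrite vmax; have : 0 <= Num.max t 0 by rewrite le_max lexx orbT.
move: (Num.max t 0) => x x0.
have [c c_ge0 cP] := vP x; have [M M0 MP] := iterate_bounded x.
(* The limit is within [c] of the iterate 0, so [M + c] bounds the limit and all iterates at
   once. *)
have [l l0 lP] := Phi_contraction x (M + c).
have vM s : 0 <= s <= x -> `|v s| <= M + c.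
  move=> sx; rewrite -(subrK (iterate 0 s) (v s)) addrC (le_trans (ler_normD _ _))// lerD ?(MP 0%N)//.
  by rewrite -[leRHS]mulr1; exact: (cP 0%N).
have xx : 0 <= x <= x by rewrite x0 lexx.
suff : v x - Phi v x = 0 by move/subr0_eq => ->; rewrite /Phi (max_idPl x0).
(* [v - Phi v] is split at [iterate k.+1], which is [Phi (iterate k)]: one piece is the convergence
   error, the other its image under the contraction. Both decay geometrically. *)
apply: (@geometric_le0 _ (c + c * expR (l * x))) => k.
rewrite -(subrKA (iterate k.+1 x)) (le_trans (ler_normD _ _))// mulrDl lerD//.
  rewrite (le_trans (cP k.+1 _ xx))// ler_wpM2l// exprS ler_piMl ?exprn_ge0//.
  by rewrite invf_le1// ler1n.
have ck0 : 0 <= c * 2^-1 ^+ k by rewrite mulr_ge0 ?exprn_ge0.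
apply: (@le_trans _ _ (c * 2^-1 ^+ k / 2 * expR (l * x))).
  rewrite distrC; apply: (lP v (iterate k)) => //.
  - by move=> s sx; rewrite (le_trans (MP k _ sx))// lerDl.
  - move=> s sx; rewrite (le_trans (cP k _ sx))// ler_peMr//.
    by rewrite -[leLHS]expR0 ler_expR mulr_ge0//; case/andP: sx.
rewrite [leRHS]mulrAC ler_wpM2r ?expR_ge0// ler_piMr// invf_le1 ?ler1n// ltr0n.
Qed.

End volterra.

(** * Abel inversion *)

Section abel.
Context {R : realType}.
Notation mu := (@lebesgue_measure R).
Implicit Types (f w n v : R -> R) (a b c e l p q r x t s z al T A B K M D : R).

Let conv_integrandE p q n t s : 0 < t -> 0 < s < 1 ->
  (t - (0 + (t - 0) * s)) `^ (p - 1) * (0 + (t - 0) * s) `^ (q - 1) * n (0 + (t - 0) * s) =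
  (t `^ (p - 1) * t `^ (q - 1)) * (beta_weight p q s * n (t * s)).
Proof.
move=> t0 /andP[s0 s1]; rewrite !subr0 !add0r -{1}(mulr1 t) -mulrBr.
rewrite (@powRM _ t (1 - s)) ?(@powRM _ t s) ?subr_ge0 ?ltW// /beta_weight; ring.
Qed.

Let measurable_conv p q n t : continuous n ->
  measurable_fun (`]0%R, t[ : set (measurableTypeR R)) (fun s => (t - s) `^ (p - 1) * s `^ (q - 1) * n s).
Proof.
move=> cn; apply: measurable_funTS; apply: measurable_funM; last exact: continuous_measurable_fun.
apply: measurable_funM; last exact: measurable_powR.
apply: (@measurableT_comp _ _ _ _ _ _ (fun x : R => x `^ (p - 1)) _ (fun x : R => t - x)) => //.
exact: measurable_funB.
Qed.

Let integrable_conv01 p q n t : 0 < p <= 1 -> 0 < q <= 1 -> continuous n -> 0 < t ->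
  mu.-integrable `]0, 1[ (EFin \o (fun s => (t - (0 + (t - 0) * s)) `^ (p - 1) *
    (0 + (t - 0) * s) `^ (q - 1) * n (0 + (t - 0) * s))).
Proof.
move=> p01 q01 cn t0.
have := @integrableZR _ _ _ mu `]0, 1[ _ (t `^ (p - 1) * t `^ (q - 1)) (measurable_itv _)
  (integrable_avg t (integrable_beta_weight p01 q01) cn).
apply: eq_integrable => // s; rewrite inE /= in_itv/= => s01.
by rewrite conv_integrandE.
Qed.

Lemma integrable_conv p q n t : 0 < p <= 1 -> 0 < q <= 1 -> continuous n -> 0 < t ->
  mu.-integrable `]0, t[ (EFin \o (fun s => (t - s) `^ (p - 1) * s `^ (q - 1) * n s)).
Proof.
move=> p01 q01 cn t0; apply: integrable_affine => //; first exact: measurable_conv.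
exact: integrable_conv01.
Qed.

Lemma Rintegral_conv p q n t : 0 < p <= 1 -> 0 < q <= 1 -> continuous n -> 0 < t ->
  \int[mu]_(s in `]0, t[) ((t - s) `^ (p - 1) * s `^ (q - 1) * n s) =
  t `^ (p + q - 1) * avg (beta_weight p q) n t.
Proof.
move=> p01 q01 cn t0; rewrite Rintegral_affine//; last 2 first.
- exact: measurable_conv.
- exact: integrable_conv01.
transitivity (t * \int[mu]_(s in `]0, 1[) ((t `^ (p - 1) * t `^ (q - 1)) * (beta_weight p q s * n (t * s)))).
  rewrite {1}subr0; congr (_ * _); apply: eq_Rintegral => s; rewrite inE/= in_itv/=.
  exact: conv_integrandE.
rewrite RintegralZl//; last exact: (integrable_avg _ (integrable_beta_weight p01 q01)).
rewrite mulrA; congr (_ * _); rewrite -powRD ?(gt_eqF t0) ?implybT//.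
by rewrite -{1}(powRr1 (ltW t0)) -powRD ?(gt_eqF t0) ?implybT//; congr (_ `^ _); ring.
Qed.

(** The integral of [s ^ (a - 1) * n s] from 0 to [t], continued by 0 to negative [t]; see [primE].
    The rescaled form gives continuity at 0 at once. *)
Definition prim a n t : R := (Num.max t 0) `^ a * avg (beta_weight 1 a) n (Num.max t 0).

Let powR_sub1 x : x `^ (1 - 1) = 1. Proof. by rewrite subrr powRr0. Qed.

Lemma prim_le0 a n t : 0 < a -> t <= 0 -> prim a n t = 0.
Proof. by move=> a0 t0; rewrite /prim max_r// powR0 ?mul0r// gt_eqF. Qed.

Lemma integrable_prim a n t : 0 < a <= 1 -> continuous n -> 0 < t ->
  mu.-integrable `]0, t[ (EFin \o (fun s => s `^ (a - 1) * n s)).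
Proof.
move=> a01 cn t0; have := integrable_conv (p := 1) _ a01 cn t0.
rewrite (_ : (fun s => (t - s) `^ (1 - 1) * s `^ (a - 1) * n s) = (fun s => s `^ (a - 1) * n s)); last first.
  by apply/funext => s; rewrite powR_sub1 mul1r.
by apply; rewrite ltr01 lexx.
Qed.

Lemma primE a n t : 0 < a <= 1 -> continuous n -> 0 < t ->
  prim a n t = \int[mu]_(s in `]0, t[) (s `^ (a - 1) * n s).
Proof.
move=> a01 cn t0; rewrite /prim (max_idPl (ltW t0)).
transitivity (\int[mu]_(s in `]0, t[) ((t - s) `^ (1 - 1) * s `^ (a - 1) * n s)).
  rewrite Rintegral_conv//; last by rewrite ltr01 lexx.
  by rewrite (addrC 1) addrK.
by apply: eq_Rintegral => s _; rewrite powR_sub1 mul1r.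
Qed.

Lemma continuous_prim a n : 0 < a <= 1 -> continuous n -> continuous (prim a n).
Proof.
move=> a01 cn t; apply: cvgM; first by apply: continuous_powR_max; case/andP: a01.
apply: (@continuous_comp _ _ _ (fun t => Num.max t 0) (avg (beta_weight 1 a) n)).
  by apply: continuous_max; [exact: cvg_id|exact: cvg_cst].
by apply: continuous_avg => //; apply: integrable_beta_weight => //; rewrite ltr01 lexx.
Qed.

Lemma is_derive_prim a n t : 0 < a <= 1 -> continuous n -> 0 < t ->
  is_derive t 1 (prim a n) (t `^ (a - 1) * n t).
Proof.
move=> a01 cn t0.
pose f s := s `^ (a - 1) * n s.
have t1 : t < t + 1 by rewrite ltrDl.
have fi : mu.-integrable [set` Interval (BRight 0) (BRight (t + 1))] (EFin \o f).
  have t20 : 0 < t + 2 by rewrite addr_gt0.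
  apply: (@integrableS _ _ _ mu `]0, (t + 2)[) => //; last exact: integrable_prim.
  by move=> s; rewrite /= !in_itv/= => /andP[-> h]; rewrite (le_lt_trans h)// ltrD2l ltr1n.
have cf : {for t, continuous f}.
  by apply: cvgM; [exact: continuous_powR|exact: cn].
have [] := continuous_FTC1 t1 fi (_ : (BRight 0 < BRight t)%O) cf.
  by rewrite bnd_simp.
set F := fun y : R => _ => dF Ff.
have FE : F^`() t = t `^ (a - 1) * n t := Ff.
apply: (@near_eq_is_derive _ _ _ F); last first.
  by rewrite -FE derive1E; exact: derivableP.
near=> y.
have y0 : 0 < y by near: y; exact: lt_nbhsr.
by rewrite primE// /F -Rintegral_itv_bndo_bndc//; exact: integrable_prim.
Unshelve. all: by end_near. Qed.

Let beta_itvE p q a b s : a < b -> 0 < s < 1 ->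
  (b - (a + (b - a) * s)) `^ (p - 1) * (a + (b - a) * s - a) `^ (q - 1) =
  ((b - a) `^ (p - 1) * (b - a) `^ (q - 1)) * beta_weight p q s.
Proof.
move=> ab /andP[s0 s1].
have -> : b - (a + (b - a) * s) = (b - a) * (1 - s) by ring.
have -> : a + (b - a) * s - a = (b - a) * s by ring.
rewrite (@powRM _ (b - a) (1 - s)) ?(@powRM _ (b - a) s) ?subr_ge0 ?ltW// /beta_weight; ring.
Qed.

Let measurable_beta_itv p q a b (D : set (measurableTypeR R)) :
  measurable_fun D (fun s => (b - s) `^ (p - 1) * (s - a) `^ (q - 1)).
Proof.
apply: measurable_funTS; apply: measurable_funM.
  apply: (@measurableT_comp _ _ _ _ _ _ (fun x : R => x `^ (p - 1)) _ (fun x : R => b - x)) => //.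
  exact: measurable_funB.
apply: (@measurableT_comp _ _ _ _ _ _ (fun x : R => x `^ (q - 1)) _ (fun x : R => x - a)) => //.
exact: measurable_funB.
Qed.

Let integrable_beta01 p q a b : 0 < p <= 1 -> 0 < q <= 1 -> a < b ->
  mu.-integrable `]0, 1[ (EFin \o (fun s => (b - (a + (b - a) * s)) `^ (p - 1) * (a + (b - a) * s - a) `^ (q - 1))).
Proof.
move=> p01 q01 ab.
have := @integrableZR _ _ _ mu `]0, 1[ _ ((b - a) `^ (p - 1) * (b - a) `^ (q - 1)) (measurable_itv _)
  (integrable_beta_weight p01 q01).
apply: eq_integrable => // s; rewrite inE /= in_itv/= => s01.
by rewrite beta_itvE.
Qed.

Lemma integrable_beta_itv p q a b : 0 < p <= 1 -> 0 < q <= 1 -> a < b ->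
  mu.-integrable `]a, b[ (EFin \o (fun s => (b - s) `^ (p - 1) * (s - a) `^ (q - 1))).
Proof.
move=> p01 q01 ab; apply: (integrable_affine ab).
- exact: measurable_beta_itv.
- exact: integrable_beta01.
Qed.

Lemma Rintegral_beta_itv p q a b : 0 < p <= 1 -> 0 < q <= 1 -> a < b ->
  \int[mu]_(s in `]a, b[) ((b - s) `^ (p - 1) * (s - a) `^ (q - 1)) =
  (b - a) `^ (p + q - 1) * \int[mu]_(s in `]0, 1[) beta_weight p q s.
Proof.
move=> p01 q01 ab; rewrite (Rintegral_affine ab); last 2 first.
- exact: measurable_beta_itv.
- exact: integrable_beta01.
have ba : 0 < b - a by rewrite subr_gt0.
transitivity ((b - a) * \int[mu]_(s in `]0, 1[) (((b - a) `^ (p - 1) * (b - a) `^ (q - 1)) * beta_weight p q s)).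
  congr (_ * _); apply: eq_Rintegral => s; rewrite inE/= in_itv/=.
  exact: beta_itvE.
rewrite RintegralZl//; last exact: integrable_beta_weight.
rewrite mulrA; congr (_ * _); rewrite -powRD ?(gt_eqF ba) ?implybT//.
by rewrite -{1}(powRr1 (ltW ba)) -powRD ?(gt_eqF ba) ?implybT//; congr (_ `^ _); ring.
Qed.

Section abel_inversion.
Variables (al a t : R).
Hypotheses (al01 : 0 < al < 1) (a01 : 0 < a <= 1) (t0 : 0 < t).

(** The double integrand on the triangle [0 < r < s < t], extended by zero so that Fubini's theorem
    can be applied on the whole plane. *)
Let k n s r : R := if (0 < r) && (r < s) && (s < t) then
  (t - s) `^ (1 - al - 1) * (s - r) `^ (al - 1) * (r `^ (a - 1) * n r) else 0.

Let al01' : 0 < al <= 1. Proof. by case/andP: al01 => -> /ltW. Qed.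
Let nal01' : 0 < 1 - al <= 1. Proof. by case/andP: al01 => ? ?; rewrite subr_gt0 gerBl ltW ?andbT. Qed.

Let measurable_k n : continuous n ->
  measurable_fun setT (fun z : measurableTypeR R * measurableTypeR R => k n z.1 z.2).
Proof.
move=> cn; apply: measurable_fun_ifT => //.
- apply: measurable_and; last by apply: measurable_fun_ltr.
  apply: measurable_and; first by apply: measurable_fun_ltr.
  by apply: measurable_fun_ltr.
- apply: measurable_funM; first apply: measurable_funM.
  + apply: (@measurableT_comp _ _ _ _ _ _ (fun x : R => x `^ (1 - al - 1)) _ (fun z : R * R => t - z.1)) => //.
    exact: measurable_funB.
  + apply: (@measurableT_comp _ _ _ _ _ _ (fun x : R => x `^ (al - 1)) _ (fun z : R * R => z.1 - z.2)) => //.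
    exact: measurable_funB.
  + apply: (@measurableT_comp _ _ _ _ _ _ (fun x : R => x `^ (a - 1) * n x) _ (fun z : R * R => z.2)) => //.
    by apply: measurable_funM; [exact: measurable_powR|exact: continuous_measurable_fun].
  exact: measurable_snd.
Qed.

Let beta_const := \int[mu]_(s in `]0, 1[) beta_weight (1 - al) al s.

(** The exponents [- al] and [al - 1] add up to -1, so the inner integral scales like [(t - r) ^ 0]:
    it is the same constant for every [r]. This cancellation is the core of Abel's inversion. *)
Let int_k1 n r : (\int[mu]_s (k n s r)%:E)%E =
  (((fun r => beta_const * (r `^ (a - 1) * n r)) \_ `]0%R, t[) r)%:E.
Proof.
rewrite patchE; case: ifPn => [|rt]; last first.
  rewrite integral0_eq// => s _; rewrite /k; case: ifPn => // /andP[/andP[r0 rs] st].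
  by move: rt; rewrite notin_setE/= in_itv/= r0 (lt_trans rs st).
rewrite inE/= in_itv/= => /andP[r0 rt].
have bi := integrable_beta_itv nal01' al01' rt.
transitivity (\int[mu]_(s in `]r, t[) ((r `^ (a - 1) * n r) * ((t - s) `^ (1 - al - 1) * (s - r) `^ (al - 1)))%:E)%E.
  rewrite [RHS]integral_mkcond; apply: eq_integral => s _.
  rewrite patchE /k r0/=; case: ifPn => [rst|nrst].
    by rewrite mem_set/= ?in_itv// mulrC.
  by rewrite memNset//= in_itv/=; exact/negP.
rewrite -[LHS]fineK; last first.
  by apply: integrable_fin_num => //; exact: (integrableZR _ _ bi).
congr EFin; rewrite -/(Rintegral _ _ _) RintegralZl// Rintegral_beta_itv// mulrC.
by rewrite (_ : 1 - al + al - 1 = 0) ?powRr0 ?mul1r//; ring.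
Qed.

Let int_k2 n s : continuous n -> (\int[mu]_r (k n s r)%:E)%E =
  (((fun s => (t - s) `^ (1 - al - 1) * (s `^ (al + a - 1) * avg (beta_weight al a) n s)) \_ `]0%R, t[) s)%:E.
Proof.
move=> cn; rewrite patchE; case: ifPn => [|st]; last first.
  rewrite integral0_eq// => r _; rewrite /k; case: ifPn => // /andP[/andP[r0 rs] st'].
  by move: st; rewrite notin_setE/= in_itv/= (lt_trans r0 rs) st'.
rewrite inE/= in_itv/= => /andP[s0 st].
have ci := integrable_conv al01' a01 cn s0.
transitivity (\int[mu]_(r in `]0%R, s[) ((t - s) `^ (1 - al - 1) * ((s - r) `^ (al - 1) * r `^ (a - 1) * n r))%:E)%E.
  rewrite [RHS]integral_mkcond; apply: eq_integral => r _.
  rewrite patchE /k st andbT; case: ifPn => [rs|nrs].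
    by rewrite mem_set/= ?in_itv// !mulrA.
  by rewrite memNset//= in_itv/=; exact/negP.
rewrite -[LHS]fineK; last first.
  by apply: integrable_fin_num => //; exact: (integrableZR _ _ ci).
by congr EFin; rewrite -/(Rintegral _ _ _) RintegralZl// Rintegral_conv.
Qed.

(** Exchange of the two integrations over the triangle. One order ([int_k2]) gives the left-hand
    side, the other ([int_k1]) the constant times the primitive. *)
Lemma abel_inversion n : continuous n ->
  \int[mu]_(s in `]0, t[) ((t - s) `^ (1 - al - 1) * (s `^ (al + a - 1) * avg (beta_weight al a) n s)) =
  (\int[mu]_(s in `]0, 1[) beta_weight (1 - al) al s) * prim a n t.
Proof.
move=> cn.
have cnn : continuous (fun r => `|n r|).
  by move=> r; apply: continuous_comp; [exact: cn|exact: norm_continuous].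
have mk : measurable_fun setT (fun z : measurableTypeR R * measurableTypeR R => (k n z.1 z.2)%:E).
  by apply/measurable_EFinP; exact: measurable_k.
(* The absolute value of the kernel is the kernel built from [|n|], so the computation in [int_k1]
   also yields absolute integrability. *)
have ik : (mu \x mu)%E.-integrable setT (fun z : measurableTypeR R * measurableTypeR R => (k n z.1 z.2)%:E).
  apply/integrable21ltyP => //=.
  have normk s r : `|k n s r| = k (fun r => `|n r|) s r.
    rewrite /k; case: ifPn => _; last by rewrite normr0.
    by rewrite !normrM !(ger0_norm (powR_ge0 _ _)).
  have -> : (fun y => \int[mu]_x `|k n x y|%:E)%E =
      (fun r => (((fun r => beta_const * (r `^ (a - 1) * `|n r|)) \_ `]0%R, t[) r)%:E).
    by apply/funext => r; rewrite -int_k1; apply: eq_integral => s _; rewrite normk.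
  apply: integrable_lty => //.
  rewrite -[X in mu.-integrable _ X]/(EFin \o _) -restrict_EFin.
  apply/(@integrable_mkcond _ _ _ mu `]0%R, t[) => //.
  by apply: integrableZR => //; exact: integrable_prim.
have := Fubini ik => /=.
under eq_integral do rewrite int_k2//.
under [in RHS]eq_integral do rewrite int_k1.
move/(congr1 fine) => E; rewrite [LHS]Rintegral_mkcond; apply: (etrans E).
transitivity (\int[mu]_x (((fun r => beta_const * (r `^ (a - 1) * n r)) \_ `]0, t[) x)); first by [].
rewrite -Rintegral_mkcond RintegralZl//; last exact: integrable_prim.
by rewrite primE.
Qed.

End abel_inversion.

End abel.

(** * Solutions of the delay equation *)

Section abs_continuous_prim.
Context {R : realType}.
Notation mu := (@lebesgue_measure R).
Implicit Types (f w n v : R -> R) (a b c e l p q r x t s z al T A B K M D : R).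

Lemma integrable_oo_cc f b c : mu.-integrable `]b, c[ (EFin \o f) ->
  mu.-integrable `[b, c] (EFin \o f).
Proof.
move=> /integrableP[mf fi].
have mnf : measurable_fun `]b, c[ (fun s => `|(EFin \o f) s|%E) by exact: measurableT_comp.
apply/integrableP; split.
  by apply/measurable_EFinP/measurable_fun_itv_bndo_bndcP/measurable_fun_itv_obnd_cbndP/measurable_EFinP.
rewrite -integral_itv_bndo_bndc; last exact/emeasurable_fun_itv_obnd_cbndP.
by rewrite -integral_itv_obnd_cbnd.
Qed.

Lemma Rintegral_oo_cc f b c : mu.-integrable `]b, c[ (EFin \o f) ->
  \int[mu]_(s in `[b, c]) f s = \int[mu]_(s in `]b, c[) f s.
Proof.
move=> fi; rewrite -Rintegral_itv_bndo_bndc ?Rintegral_itv_obnd_cbnd//.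
apply: (@integrableS _ _ _ mu `[b, c]) => //; last exact: integrable_oo_cc.
by apply: subset_itvl; rewrite bnd_simp.
Qed.

(** The cut-off to []0, t[] makes one function, integrable on the whole line, represent the
    increments over all subintervals of [[0, t]]. *)
Lemma prim_itvB a n b c t : 0 < a <= 1 -> continuous n -> 0 <= b -> b < c -> c <= t ->
  prim a n c - prim a n b = \int[mu]_(s in `]b, c[) ((fun s => s `^ (a - 1) * n s) \_ `]0, t[) s.
Proof.
move=> a01 cn b0 bc ct; have c0 : 0 < c by exact: le_lt_trans bc.
have ci := integrable_prim a01 cn c0.
transitivity (\int[mu]_(s in `]b, c[) (s `^ (a - 1) * n s)); last first.
  apply: eq_Rintegral => s; rewrite inE/= in_itv/= => /andP[bs sc].
  by rewrite patchE mem_set//= in_itv/= (le_lt_trans b0 bs) (lt_le_trans sc).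
rewrite (primE a01 cn c0); move: b0; rewrite le_eqVlt => /predU1P[<-|b0].
  by rewrite prim_le0 ?subr0//; case/andP: a01.
rewrite (primE a01 cn b0) (@Rintegral_itv_bndo_bndc R (BRight 0) b); last exact: integrable_prim.
by rewrite Rintegral_itvB// bnd_simp// ltW.
Qed.

(** Absolute continuity of the integral: [|h|] has a small integral over any set of small measure,
    here the disjoint union of the given intervals, whose measure is the sum of their lengths. *)
Lemma abs_continuous_prim a n t : 0 < a <= 1 -> continuous n -> 0 < t ->
  abs_continuous 0 t (prim a n).
Proof.
move=> a01 cn t0 e e0.
pose h := (fun s => s `^ (a - 1) * n s) \_ `]0, t[.
have hi : mu.-integrable setT (EFin \o h).
  rewrite /h -restrict_EFin; apply/(@integrable_mkcond _ _ _ mu `]0, t[) => //.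
  exact: integrable_prim.
have hni := integrable_norm hi.
have [d [d0 dP]] := integral_normr_continuous hi e0.
exists d => // m u v uv tI sd.
pose I (i : 'I_m) : set (measurableTypeR R) := `]u i, v i[.
have mI i : measurable (I i) by exact: measurable_itv.
pose A := \big[setU/set0]_(i < m) I i.
have mA : measurable A by exact: bigsetU_measurable.
have muA : (mu A < d%:E)%E.
  rewrite /A measure_bigsetU_ord// (eq_bigr (fun i => (v i - u i)%:E)); last first.
    move=> i _; transitivity (lebesgue_measure (`]u i, v i[ : set R)); first by [].
    rewrite lebesgue_measure_itv/= lte_fin; have [_ [uvi _]] := uv i.
    by case: ltgtP uvi => // -> _; rewrite subrr.
  by rewrite sumEFin lte_fin.
apply: le_lt_trans (dP A mA muA); rewrite -lee_fin.
have hAi i : mu.-integrable (I i) (EFin \o (fun s => `|h s|)) by exact: (@integrableS _ _ _ mu setT).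
have hA : mu.-integrable A (EFin \o (fun s => `|h s|)) by exact: (@integrableS _ _ _ mu setT).
rewrite /Rintegral fineK; last exact: integrable_fin_num.
rewrite /A ge0_integral_bigsetU//; last 3 first.
- exact: index_enum_uniq.
- by apply: sub_trivIset tI.
- by have /integrableP[] := hA.
rewrite -sumEFin; apply: lee_sum => i _.
have [ui0 [uvi vit]] := uv i.
move: uvi; rewrite le_eqVlt => /predU1P[->|uvi].
  by rewrite subrr normr0 integral_ge0// => x _; rewrite lee_fin.
rewrite (prim_itvB a01 cn ui0 uvi vit) -/h.
have hIi : mu.-integrable (I i) (EFin \o h) by exact: (@integrableS _ _ _ mu setT).
apply: (@le_trans _ _ (\int[mu]_(s in I i) `|h s|)%:E).
  by rewrite lee_fin; exact: le_normr_Rintegral.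
by rewrite /Rintegral fineK//; exact: integrable_fin_num.
Qed.

Lemma prim_dist_le a n n' t B : 0 < a <= 1 -> continuous n -> continuous n' -> 0 <= t ->
  (forall s, 0 <= s <= t -> `|n s - n' s| <= B) ->
  `|prim a n t - prim a n' t| <= t `^ a * (B * \int[mu]_(s in `]0, 1[) beta_weight 1 a s).
Proof.
move=> a01 cn cn' t0 nn'; rewrite /prim (max_idPl t0) -mulrBr normrM (ger0_norm (powR_ge0 _ _)).
rewrite ler_wpM2l ?powR_ge0//.
have bi : mu.-integrable `]0, 1[ (EFin \o beta_weight 1 a).
  by apply: integrable_beta_weight => //; rewrite ltr01 lexx.
apply: (le_trans (@avg_dist_le _ _ n n' t B 0 bi (beta_weight_ge0 1 a) cn cn' _)).
  move=> s /andP[s0 s1]; rewrite !mul0r expR0 mulr1; apply: nn'.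
  by rewrite mulr_ge0 ?(ltW s0)//= ler_piMr// ltW.
by under eq_Rintegral do rewrite !mul0r expR0 mulr1.
Qed.

End abs_continuous_prim.

Section delay_equation.
Context {R : realType}.
Notation mu := (@lebesgue_measure R).
Variables (al a p q tau L : R) (F dF phi dphi : R -> R).
Implicit Types (w n v : R -> R) (b c e l r x t s z T A B K M D : R).
Hypotheses (al01 : 0 < al <= 1) (a01 : 0 < a <= 1) (tau0 : 0 <= tau).
Hypothesis F_deriv : forall x, is_derive x 1 F (dF x).
Hypothesis dF_continuous : continuous dF.
Hypothesis dF_bounded : forall x, `|dF x| <= L.
Hypothesis dF_lipschitz : forall M, exists2 K : R, 0 <= K &
  forall x z, `|x| <= M -> `|z| <= M -> `|dF x - dF z| <= K * `|x - z|.
Hypothesis phi_deriv : forall t, is_derive t 1 phi (dphi t).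
Hypothesis dphi_continuous : continuous dphi.
Hypothesis dphi_ge0 : forall t, 0 <= t -> dphi t = 0.

Let g0 := - p * phi 0 + q * F (phi (- tau)).

(* If [0 < tau], compatibility of the history with the equation at time 0 removes
   the singularity of [x'] at 0, and hence those at the multiples of [tau]; if
   [tau = 0], the singularity [t `^ (al - 1)] cannot be avoided. *)
Hypothesis compat : (tau = 0 /\ a = al) \/ (0 < tau /\ a = 1 /\ g0 = 0).

Let phi_continuous : continuous phi.
Proof. by move=> t; have [/derivable1_diffP/differentiable_continuous] := phi_deriv t. Qed.

Let F_continuous : continuous F.
Proof. by move=> t; have [/derivable1_diffP/differentiable_continuous] := F_deriv t. Qed.

Let X v t := phi t + prim a v t.

Let X_continuous v : continuous v -> continuous (X v).
Proof. by move=> cv t; apply: cvgD; [exact: phi_continuous|exact: continuous_prim]. Qed.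

(** Chosen so that the right-hand side of the delay equation along [X v] has derivative
    [t ^ (a - 1) * N v t] ([is_derive_G]). Of the two summands [dphi] and [v], only one counts:
    [dphi] vanishes at nonnegative times, and at negative times [v] is read at 0, where it is 0 if
    [0 < tau]. *)
Let N v s := - p * v (Num.max s 0) +
  q * dF (X v (s - tau)) * (dphi (s - tau) + v (Num.max (s - tau) 0)).

Let continuous_max0 v : continuous v -> continuous (fun s => v (Num.max s 0)).
Proof.
move=> cv s; apply: (@continuous_comp _ _ _ (fun s => Num.max s 0) v); last exact: cv.
by apply: continuous_max; [exact: cvg_id|exact: cvg_cst].
Qed.

Let continuous_delay v : continuous v -> continuous (fun s => v (s - tau)).
Proof.
move=> cv s; apply: (@continuous_comp _ _ _ (fun s => s - tau) v); last exact: cv.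
by apply: continuousB; [exact: cvg_id|exact: cvg_cst].
Qed.

Let N_continuous v : continuous v -> continuous (N v).
Proof.
move=> cv s; apply: cvgD; first by apply: cvgM; [exact: cvg_cst|exact: continuous_max0].
apply: cvgM.
  apply: cvgM; first exact: cvg_cst.
  apply: (@continuous_comp _ _ _ (fun s => X v (s - tau)) dF); last exact: dF_continuous.
  by apply: continuous_delay; exact: X_continuous.
apply: cvgD; first exact: continuous_delay.
by apply: (continuous_delay (continuous_max0 cv)).
Qed.

Let delay_max T s : 0 <= s <= T -> 0 <= Num.max (s - tau) 0 <= s.
Proof. by move=> /andP[s0 _]; rewrite le_max lexx orbT/= ge_max s0 gerBl tau0. Qed.

Let L0 : 0 <= L. Proof. exact: le_trans (dF_bounded 0). Qed.

Let N_growth T : exists2 A : R, 0 <= A & forall v l M, continuous v ->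
  0 <= l -> 0 <= M -> (forall s, 0 <= s <= T -> `|v s| <= M * expR (l * s)) ->
  forall s, 0 <= s <= T -> `|N v s| <= A * (1 + M * expR (l * s)).
Proof.
have [B BP] := continuous_bounded (- tau) T dphi_continuous.
exists (`|p| + `|q| * L * (`|B| + 1)).
  by rewrite addr_ge0// mulr_ge0 ?mulr_ge0 ?addr_ge0.
move=> v l M cv l0 M0 vM s sT; have /andP[s0 sT'] := sT.
have /andP[r0 rs] := delay_max sT.
have E0 : 0 <= M * expR (l * s) by rewrite mulr_ge0 ?expR_ge0.
have h1 : `|v (Num.max s 0)| <= M * expR (l * s) by rewrite (max_idPl s0); exact: vM.
have h2 : `|v (Num.max (s - tau) 0)| <= M * expR (l * s).
  apply: (le_trans (vM _ _)); first by rewrite r0 (le_trans rs).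
  by rewrite ler_wpM2l// ler_expR ler_wpM2l.
have h3 : `|dphi (s - tau)| <= `|B|.
  apply: (le_trans (BP (s - tau) _)); last exact: ler_norm.
  by rewrite -{1}(add0r (- tau)) lerD2r s0 lerBlDr (le_trans sT')// lerDl.
rewrite /N (le_trans (ler_normD _ _))// !normrM normrN mulrDl; apply: lerD.
  by rewrite ler_wpM2l// (le_trans h1)// lerDr.
rewrite -[leRHS]mulrA; apply: ler_pM; rewrite ?mulr_ge0//.
  by rewrite ler_wpM2l.
rewrite (le_trans (ler_normD _ _))// (le_trans (lerD h3 h2))//.
have := normr_ge0 B; nra.
Qed.

Let N_lipschitz T M : exists2 K : R, 0 <= K &
  forall v v' l D, continuous v -> continuous v' -> 0 <= l -> 0 <= D ->
  (forall s, 0 <= s <= T -> `|v s| <= M) -> (forall s, 0 <= s <= T -> `|v' s| <= M) ->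
  (forall s, 0 <= s <= T -> `|v s - v' s| <= D * expR (l * s)) ->
  forall s, 0 <= s <= T -> `|N v s - N v' s| <= K * D * expR (l * s).
Proof.
have [B BP] := continuous_bounded (- tau) T dphi_continuous.
have [P PP] := continuous_bounded (- tau) T phi_continuous.
pose W := \int[mu]_(s in `]0, 1[) beta_weight 1 a s.
have W0 : 0 <= W by apply: Rintegral_ge0 => s _; exact: beta_weight_ge0.
have [K K0 KP] := dF_lipschitz (`|P| + T `^ a * (M * W)).
exists (`|p| + `|q| * (L + K * (T `^ a * W) * (`|B| + `|M|))).
  by rewrite addr_ge0// mulr_ge0// addr_ge0// mulr_ge0 ?mulr_ge0 ?powR_ge0 ?addr_ge0.
move=> v v' l D cv cv' l0 D0 vM v'M vv' s sT; have /andP[s0 sT'] := sT.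
have /andP[r0 rs] := delay_max sT.
set r := Num.max (s - tau) 0 in r0 rs *.
have rT : 0 <= r <= T by rewrite r0 (le_trans rs).
have T0 : 0 <= T by exact: le_trans sT'.
have a0 : 0 <= a by case/andP: a01 => /ltW.
have raT : r `^ a <= T `^ a by rewrite ge0_ler_powR ?nnegrE//; case/andP: rT.
pose E := D * expR (l * s).
have E0 : 0 <= E by rewrite mulr_ge0 ?expR_ge0.
have vvE z : 0 <= z <= s -> `|v z - v' z| <= E.
  move=> /andP[z0 zs]; apply: (le_trans (vv' _ _)); first by rewrite z0 (le_trans zs).
  by rewrite ler_wpM2l// ler_expR ler_wpM2l.
have prim_max n : prim a n (s - tau) = prim a n r by rewrite /prim /r -maxA maxxx.
have XM n : continuous n -> (forall s, 0 <= s <= T -> `|n s| <= M) ->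
    `|X n (s - tau)| <= `|P| + T `^ a * (M * W).
  move=> cn nM; rewrite (le_trans (ler_normD _ _))// lerD//.
    apply: (le_trans (PP (s - tau) _)); last exact: ler_norm.
  by rewrite -{1}(add0r (- tau)) lerD2r s0 lerBlDr (le_trans sT')// lerDl.
  have M0 : 0 <= M by apply: le_trans (nM 0 _); rewrite ?lexx.
  have c0 : continuous (cst 0 : R -> R) by move=> z; exact: cvg_cst.
  have := @prim_dist_le _ a n (cst 0) r M a01 cn c0 r0.
  have -> : prim a (cst 0) r = 0.
    rewrite /prim /avg; under eq_Rintegral do rewrite /= mulr0.
    by rewrite Rintegral_cst// mul0r mulr0.
  rewrite subr0 prim_max => /(_ _)/le_trans; apply.
    by move=> z /andP[z0 zr]; rewrite /= subr0; apply: nM; rewrite z0 (le_trans zr)//; case/andP: rT.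
  by rewrite ler_wpM2r// mulr_ge0.
have dX : `|X v (s - tau) - X v' (s - tau)| <= T `^ a * W * E.
  rewrite /X opprD addrACA subrr add0r !prim_max.
  apply: (le_trans (prim_dist_le a01 cv cv' r0 (B := E) _)).
    by move=> z /andP[z0 zr]; apply: vvE; rewrite z0 (le_trans zr).
  by rewrite (mulrC E) mulrA ler_wpM2r// ler_wpM2r.
have ddF : `|dF (X v (s - tau)) - dF (X v' (s - tau))| <= K * (T `^ a * W * E).
  by apply: (le_trans (KP _ _ (XM _ cv vM) (XM _ cv' v'M))); rewrite ler_wpM2l.
have h3 : `|dphi (s - tau) + v' r| <= `|B| + `|M|.
  rewrite (le_trans (ler_normD _ _))// lerD//.
    apply: (le_trans (BP (s - tau) _)); last exact: ler_norm.
  by rewrite -{1}(add0r (- tau)) lerD2r s0 lerBlDr (le_trans sT')// lerDl.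
  by rewrite (le_trans (v'M _ rT))// ler_norm.
rewrite /N -/r (max_idPl s0).
(* The product is telescoped so that its first difference needs only the bound [L] on [dF], and its
   second the local Lipschitz constant of [dF] and the bound on [v']. *)
rewrite (_ : _ - _ = - p * (v s - v' s) + q * (dF (X v (s - tau)) * (v r - v' r) +
   (dF (X v (s - tau)) - dF (X v' (s - tau))) * (dphi (s - tau) + v' r))); last by ring.
rewrite -[leRHS]mulrA -/E [leRHS]mulrDl (le_trans (ler_normD _ _))// !normrM normrN lerD//.
  by rewrite ler_wpM2l// vvE// s0 lexx.
rewrite -[leRHS]mulrA ler_wpM2l// (le_trans (ler_normD _ _))// [leRHS]mulrDl !normrM lerD//.
  by apply: ler_pM => //; apply: vvE; rewrite r0 rs.
rewrite (_ : K * _ * _ * E = K * (T `^ a * W * E) * (`|B| + `|M|)); last by ring.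
exact: ler_pM.
Qed.

Let cone : continuous (fun _ : R => 1 : R). Proof. by move=> z; exact: cvg_cst. Qed.

Let a_gt0 : 0 < a. Proof. by case/andP: a01. Qed.

Let prim0 n : prim a n 0 = 0. Proof. exact: prim_le0. Qed.

Let is_derive_X v t : continuous v -> 0 < t -> is_derive t 1 (X v) (t `^ (a - 1) * v t).
Proof.
move=> cv t0; have h := @is_deriveD R R R phi (prim a v) t 1 _ _ (phi_deriv t) (is_derive_prim a01 cv t0).
by apply: (is_derive_eq h); rewrite dphi_ge0 ?add0r// ltW.
Qed.

Let is_derive_Xneg v t : t < 0 -> is_derive t 1 (X v) (dphi t).
Proof.
move=> t0; apply: (@near_eq_is_derive _ _ _ phi) => //.
near=> s; have s0 : s < 0 by near: s; exact: lt_nbhsl.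
by rewrite /X prim_le0 ?addr0// ltW.
Unshelve. all: by end_near. Qed.

Let G v t := - p * X v t + q * F (X v (t - tau)).

Let G_continuous v : continuous v -> continuous (G v).
Proof.
move=> cv t; apply: cvgD; first by apply: cvgM; [exact: cvg_cst|exact: X_continuous].
apply: cvgM; first exact: cvg_cst.
apply: (@continuous_comp _ _ _ (fun s => X v (s - tau)) F); last exact: F_continuous.
by apply: continuous_delay; exact: X_continuous.
Qed.

(** At [t = tau] the delayed argument is 0, where the left and right formulas for the derivative of
    [X v] meet; this point is left out. Before [tau], [v 0 = 0] removes the spurious term of [N]. *)
Let is_derive_G v t : continuous v -> (0 < tau -> v 0 = 0) -> 0 < t -> t != tau ->
  is_derive t 1 (G v) (t `^ (a - 1) * N v t).
Proof.
move=> cv v0 t0 ttau.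
have dX : is_derive (t - tau) 1 (X v) (t `^ (a - 1) * (dphi (t - tau) + v (Num.max (t - tau) 0))).
  case: compat => [[tau_eq0 _]|[tau_gt0 [a1 _]]].
    rewrite tau_eq0 subr0 (max_idPl (ltW t0)) dphi_ge0 ?add0r ?ltW//.
    exact: is_derive_X.
  have [tt|tt] := ltP (t - tau) 0.
    apply: (is_derive_eq (is_derive_Xneg v tt)).
    by rewrite v0// addr0 a1 subrr powRr0 mul1r.
  have tt' : 0 < t - tau by rewrite lt_neqAle tt andbT eq_sym subr_eq0.
  apply: (is_derive_eq (is_derive_X cv tt')).
  by rewrite dphi_ge0// add0r a1 subrr !powRr0.
have dshift : is_derive t 1 (fun s : R => s - tau) 1.
  have h := @is_deriveB R R R id (cst tau) t 1 1 0 (is_derive_id _ _) (is_derive_cst _ _ _).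
  by apply: (is_derive_eq h); rewrite subr0.
have dXs := @is_derive1_comp R (X v) (fun s : R => s - tau) t _ _ dX dshift.
have dFX := @is_derive1_comp R F (X v \o (fun s : R => s - tau)) t _ _ (F_deriv _) dXs.
have h1 := @is_deriveZ R R R _ (- p) t 1 _ (is_derive_X cv t0).
have h2 := @is_deriveZ R R R _ q t 1 _ dFX.
have h := @is_deriveD R R R _ _ t 1 _ _ h1 h2.
apply: (is_derive_eq h); rewrite /GRing.scale/= /N (max_idPl (ltW t0)); ring.
Qed.

(** [G v - prim a (N v)] is continuous and has derivative 0 except possibly at [tau], so it is
    constant up to [tau] and from [tau] on, hence constant. *)
Let G_prim v t : continuous v -> (0 < tau -> v 0 = 0) -> 0 <= t ->
  G v t = g0 + prim a (N v) t.
Proof.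
move=> cv v0 t0.
pose H s := G v s - prim a (N v) s.
have cH : continuous H.
  by move=> s; apply: cvgB; [exact: G_continuous|apply: continuous_prim => //; exact: N_continuous].
have dH s : 0 < s -> s != tau -> is_derive s 1 H 0.
  move=> s0 st; have h := @is_deriveB R R R _ _ s 1 _ _ (is_derive_G cv v0 s0 st) (is_derive_prim a01 (N_continuous cv) s0).
  by apply: (is_derive_eq h); rewrite subrr.
have Hcst b c : 0 <= b -> b <= c -> (forall s, b < s < c -> s != tau) -> H c = H b.
  move=> b0 bc bct; apply/eqP; rewrite -subr_eq0; apply/eqP.
  have [||s _ ->] := @MVT_segment R H (fun _ => 0) b c bc; last by rewrite mul0r.
    move=> s; rewrite in_itv/= => /andP[bs sc]; apply: dH; first exact: le_lt_trans bs.
    by apply: bct; rewrite bs.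
  exact: continuous_subspaceT.
suff : H t = H 0.
  rewrite /H prim0 subr0 => /eqP; rewrite subr_eq => /eqP ->.
  by rewrite /G /X sub0r prim0 prim_le0 ?oppr_le0// !addr0.
have [ttau|ttau] := leP t tau.
  by apply: Hcst => // s /andP[_ st]; rewrite lt_eqF// (lt_le_trans st).
rewrite (@Hcst tau t tau0 (ltW ttau)); last by move=> s /andP[st _]; rewrite gt_eqF.
by apply: Hcst => // s /andP[_ st]; rewrite lt_eqF.
Qed.

Let B := \int[mu]_(s in `]0, 1[) beta_weight (1 - al) al s.

(** Since the Beta integral [B] equals the product of the Gamma values at [al] and [1 - al], this is
    [1 / Gamma al], the normalisation of the fractional integral; written as here, it does not rely
    on that identity. *)
Let C := if al == 1 then 1 else Gamma (1 - al) / B.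

Let al_lt1 : al != 1 -> 0 < al < 1.
Proof. by move=> al1; case/andP: al01 => -> alle; rewrite lt_neqAle al1. Qed.

Let al1_a : al = 1 -> a = 1.
Proof. by move=> al1; case: compat => [[_ ->]|[_ []]]. Qed.

Let B_gt0 : al != 1 -> 0 < B.
Proof.
move=> /al_lt1 /andP[al0 al1]; apply: (@lt_le_trans _ _ 1) => //; apply: Rintegral01_ge1.
  by apply: integrable_beta_weight; rewrite ?al0 ?(ltW al1)// subr_gt0 al1 gerBl ltW.
by move=> s s01; apply: beta_weight_ge1; rewrite ?(ltW al1)// gerBl ltW.
Qed.

Let C_gt0 : 0 < C.
Proof.
rewrite /C; case: ifPn => // al1; rewrite divr_gt0 ?B_gt0//.
by apply: Gamma_gt0; have := al_lt1 al1; lra.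
Qed.

(** For [al < 1], the Volterra equation is inserted in the Caputo integral of [X v]. The constant
    [g0] contributes [g0 * B], because [a = al] or [g0 = 0]; the rest contributes
    [B * prim a (N v) t] by [abel_inversion]. The factor [C / Gamma (1 - al) = 1 / B] leaves
    [g0 + prim a (N v) t], which is the right-hand side by [G_prim]. *)
Lemma delay_solution : exists x u : R -> R, [/\ continuous x, forall t, t <= 0 -> x t = phi t,
  forall t, 0 < t -> is_derive t 1 x (u t), forall t, 0 < t -> {for t, continuous u} &
  forall t, 0 < t -> has_caputo al x t (- p * x t + q * F (x (t - tau)))].
Proof.
pose w s := C * beta_weight al a s.
have wi : mu.-integrable `]0, 1[ (EFin \o w).
  by apply: integrableZR => //; exact: integrable_beta_weight.
have w0 s : 0 <= w s by rewrite mulr_ge0 ?beta_weight_ge0// ltW.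
have al0 : 0 < al by case/andP: al01.
have [v cv vE] := volterra_solution (C * g0) wi w0 al0 N_continuous N_growth N_lipschitz.
have avgC t : avg w (N v) t = C * avg (beta_weight al a) (N v) t.
  rewrite /avg -RintegralZl//; last by apply: integrable_avg; [exact: integrable_beta_weight|exact: N_continuous].
  by apply: eq_Rintegral => s _; rewrite /w mulrA.
have vE' t : 0 <= t -> v t = C * (g0 + t `^ al * avg (beta_weight al a) (N v) t).
  by move=> t0; rewrite vE (max_idPl t0) avgC; ring.
have v0 : 0 < tau -> v 0 = 0.
  move=> tau_gt0; rewrite vE'// powR0 ?gt_eqF// mul0r addr0.
  case: compat => [[tau_eq0 _]|[_ [_ ->]]]; last by rewrite mulr0.
  by rewrite tau_eq0 ltxx in tau_gt0.
exists (X v), (fun t => t `^ (a - 1) * v t); split => //.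
- exact: X_continuous.
- by move=> t t0; rewrite /X prim_le0 ?addr0.
- by move=> t; exact: is_derive_X.
- by move=> t t0; apply: cvgM; [exact: continuous_powR|exact: cv].
move=> t t0; rewrite -/(G v t) (G_prim cv v0 (ltW t0)) /has_caputo; case: ifPn => [/eqP al1|al1].
  apply: (is_derive_eq (is_derive_X cv t0)); rewrite (al1_a al1) subrr powRr0 mul1r vE' ?ltW//.
  by rewrite /C al1 eqxx mul1r /prim (max_idPl (ltW t0)) (al1_a al1).
have al01' := al_lt1 al1; have nal01 : 0 < 1 - al <= 1 by lra.
pose f s := (t - s) `^ (1 - al - 1) * s `^ (a - 1) * v s.
have fi : mu.-integrable `]0, t[ (EFin \o f) by exact: integrable_conv.
pose k s := (t - s) `^ (- al) * derive1 (X v) s.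
have kE s : 0 < s < t -> k s = f s.
  move=> /andP[s0 st]; rewrite /k /f derive1E; have [_ ->] := is_derive_X cv s0.
  by rewrite mulrA (_ : 1 - al - 1 = - al)//; ring.
have ki : mu.-integrable `]0, t[ (EFin \o k).
  apply: eq_integrable fi => // s; rewrite inE/= in_itv/= => st; by rewrite kE.
split.
- have abs_prim := abs_continuous_prim a01 cv t0.
  (* The history is constant on nonnegative times, so [X v] and [prim a v] have the same increments
     there. *)
  move=> e e0; have [d d0 dP] := abs_prim e e0; exists d => // m b c bc tI sd.
  have phiE s : 0 <= s -> phi s = phi 0.
    move=> s0; apply/eqP; rewrite -subr_eq0; apply/eqP.
    have [|z zs ->] := @MVT_segment R phi dphi 0 s s0 (fun z _ => phi_deriv z).
      exact: continuous_subspaceT.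
    by rewrite dphi_ge0 ?mul0r//; move: zs; rewrite in_itv/= => /andP[].
  rewrite (eq_bigr (fun i => `|prim a v (c i) - prim a v (b i)|)) ?dP// => i _.
  have [b0 [bci _]] := bc i.
  by rewrite /X !phiE// ?(le_trans b0)// opprD addrACA subrr add0r.
- exact: integrable_oo_cc.
rewrite Rintegral_oo_cc//.
have -> : \int[mu]_(s in `]0, t[) k s = \int[mu]_(s in `]0, t[) f s.
  by apply: eq_Rintegral => s; rewrite inE/= in_itv/=; exact: kE.
pose f1 s := (t - s) `^ (1 - al - 1) * s `^ (a - 1) * 1.
have f1i : mu.-integrable `]0, t[ (EFin \o f1) by exact: (@integrable_conv _ (1 - al) a (fun=> 1)).
have f1E : g0 * \int[mu]_(s in `]0, t[) f1 s = g0 * B.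
  case: compat => [[_ aal]|[_ [_ ->]]]; last by rewrite !mul0r.
  rewrite /f1 (@Rintegral_conv _ (1 - al) a (fun=> 1))// aal (_ : 1 - al + al - 1 = 0); last by ring.
  rewrite powRr0 mul1r; congr (_ * _); apply: eq_Rintegral => s _; exact: mulr1.
have E2 : \int[mu]_(s in `]0, t[) (C^-1 * f s - g0 * f1 s) =
    \int[mu]_(s in `]0, t[) ((t - s) `^ (1 - al - 1) * (s `^ (al + a - 1) * avg (beta_weight al a) (N v) s)).
  apply: eq_Rintegral => s; rewrite inE/= in_itv/= => /andP[s0 st].
  rewrite /f /f1 (vE' _ (ltW s0)) (_ : al + a - 1 = a - 1 + al); last by ring.
  rewrite (@powRD _ s (a - 1) al) ?(gt_eqF s0) ?implybT//; field; exact: lt0r_neq0.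
have := @abel_inversion R al a t al01' a01 t0 (N v) (N_continuous cv).
rewrite -/B -E2.
rewrite RintegralB//; [|exact: integrableZR|exact: integrableZR].
rewrite !RintegralZl// f1E => fE.
have B0 : B != 0 by rewrite gt_eqF// B_gt0.
have -> : \int[mu]_(s in `]0, t[) f s = C * B * (g0 + prim a (N v) t).
  rewrite -mulrA mulrDr -fE; field; exact: lt0r_neq0.
rewrite /C (negbTE al1) divfK// mulKf// gt_eqF//; exact: Gamma_gt0.
Qed.

End delay_equation.

(** * Extension of the feedback *)

Section feedback.
Context {R : realType}.
Implicit Types (F G : R -> R) (m x y z t s h e : R).

(** By the mean value theorem a difference quotient at [m] equals [G z] with [z] strictly between
    [m] and the other point, and [G] is continuous at [m]. *)
Lemma is_derive_glue F G m : (forall y, y != m -> is_derive y 1 F (G y)) ->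
  continuous F -> {for m, continuous G} -> is_derive m 1 F (G m).
Proof.
move=> dF cF cG.
have cv : h^-1 *: (F (h *: 1 + m) - F m) @[h --> 0^'] --> G m.
  apply/cvgrPdist_lt => e e0; have /cvgrPdist_lt/(_ _ e0)[d /= d0 dP] := cG.
  exists d => //= h /=; rewrite sub0r normrN => hd h0.
  have slope b c : b < c -> `|b - m| < d -> `|c - m| < d -> (b = m \/ c = m) ->
      exists2 z, `|m - z| < d & F c - F b = G z * (c - b).
    move=> bc bm cm bcm; have [||z zbc ->] := @MVT R F G b c bc.
    - move=> z; rewrite in_itv/= => /andP[bz zc]; apply: dF; apply/eqP => zm.
      by case: bcm => E; lra.
    - exact: continuous_subspaceT.
    exists z => //; move: zbc bm cm; rewrite in_itv/= distrC !ltr_norml; lra.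
  rewrite /GRing.scale/= mulr1.
  have [hn|hp|hE] := ltgtP h 0; last by rewrite hE eqxx in h0.
  - have [z zd E] : exists2 z : R, `|m - z| < d & F m - F (h + m) = G z * (m - (h + m)).
      by apply: slope; [lra|rewrite addrK|rewrite subrr normr0|right].
    rewrite -(opprB (F m)) E (_ : h^-1 * _ = G z); first exact: dP.
    by field.
  - have [z zd E] : exists2 z : R, `|m - z| < d & F (h + m) - F m = G z * (h + m - m).
      by apply: slope; [lra|rewrite subrr normr0|rewrite addrK|left].
    rewrite E (_ : h^-1 * _ = G z); first exact: dP.
    by field.
have dm : derivable F m 1 by apply/cvg_ex; exists (G m).
by apply: DeriveDef => //; rewrite /derive; apply/cvg_lim.
Qed.

Variables (r m : R).
Hypotheses (r0 : 0 < r) (m0 : 0 <= m) (mr : 0 < m \/ 1 <= r).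

Let W y := (1 + Num.max y m `^ r)^-1.

Let max_ge0 y : 0 <= Num.max y m. Proof. by rewrite le_max m0 orbT. Qed.

Let W1 y : 1 <= 1 + Num.max y m `^ r. Proof. by rewrite lerDl powR_ge0. Qed.

Let W0 y : 0 < 1 + Num.max y m `^ r. Proof. exact: lt_le_trans (W1 y). Qed.

Let W01 y : 0 < W y <= 1. Proof. by rewrite /W invr_gt0 W0 invf_le1 ?W0 ?W1. Qed.

Let powR_max_continuous : continuous (fun y => Num.max y m `^ r).
Proof.
move=> y.
have E : (fun y => Num.max y m `^ r) = (fun t => Num.max t 0 `^ r) \o (fun y => Num.max y m).
  by apply/funext => z /=; rewrite (max_idPl (max_ge0 z)).
rewrite E; apply: continuous_comp; last exact: continuous_powR_max.
by apply: continuous_max; [exact: cvg_id|exact: cvg_cst].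
Qed.

Let W_continuous : continuous W.
Proof.
move=> y; apply: cvgV; first by rewrite gt_eqF.
by apply: cvgD; [exact: cvg_cst|exact: powR_max_continuous].
Qed.

(** The derivative of [y * W y] with [W = 1 / (1 + y ^ r)]: from [y * W' = - r * (W - W * W)].
    Written in [W] alone it avoids [y ^ (r - 1)], which is singular at 0 for [r < 1]. *)
Definition dfeedback y := (1 - r) * W y + r * (W y * W y).

(** Below [m] the graph is continued by its tangent line at [m]; above [m] the second summand is
    0. *)
Definition feedback y := Num.max y m * W y + dfeedback m * (Num.min y m - m).

Lemma feedbackE y : m <= y -> feedback y = y / (1 + y `^ r).
Proof.
by move=> my; rewrite /feedback /W (max_idPl my) (min_idPr my) subrr mulr0 addr0.
Qed.

Lemma continuous_dfeedback : continuous dfeedback.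
Proof.
move=> y; apply: cvgD; (apply: cvgM; first exact: cvg_cst); first exact: W_continuous.
by apply: cvgM; exact: W_continuous.
Qed.

Lemma continuous_feedback : continuous feedback.
Proof.
move=> y; apply: cvgD.
  apply: cvgM; last exact: W_continuous.
  by apply: continuous_max; [exact: cvg_id|exact: cvg_cst].
apply: cvgM; first exact: cvg_cst.
by apply: cvgB; [apply: continuous_min; [exact: cvg_id|exact: cvg_cst]|exact: cvg_cst].
Qed.

Lemma dfeedback_bounded y : `|dfeedback y| <= `|1 - r| + r.
Proof.
have /andP[w0 w1] := W01 y; rewrite (le_trans (ler_normD _ _))// !normrM.
rewrite (gtr0_norm r0) (gtr0_norm w0); apply: lerD; rewrite ler_piMr ?(ltW r0)//.
by rewrite mulr_ile1 ?(ltW w0).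
Qed.

Let is_derive_powRr x : 0 < x -> is_derive x 1 (fun t : R => t `^ r) (r * x `^ (r - 1)).
Proof. by move=> x0; exact: is_derive1_powR. Qed.

Lemma is_derive_feedback y : is_derive y 1 feedback (dfeedback y).
Proof.
have Fneq x : x != m -> is_derive x 1 feedback (dfeedback x).
  rewrite neq_lt => /orP[xm|mx].
  - have Wm : W x = W m by rewrite /W maxxx (max_idPr (ltW xm)).
    apply: (@near_eq_is_derive _ _ _ (fun t => m * W m + dfeedback m * (t - m))).
      near=> t; have tm : t < m by near: t; exact: lt_nbhsl.
      by rewrite /feedback /W maxxx (max_idPr (ltW tm)) (min_idPl (ltW tm)).
    have h1 := @is_deriveB R R R id (cst m) x 1 1 0 (is_derive_id _ _) (is_derive_cst _ _ _).
    have h2 := @is_deriveZ R R R _ (dfeedback m) x 1 _ h1.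
    have h3 := @is_deriveD R R R (cst (m * W m)) _ x 1 _ _ (is_derive_cst _ _ _) h2.
    apply: (is_derive_eq h3); rewrite /GRing.scale/= subr0 mulr1 add0r.
    by rewrite /dfeedback Wm.
  - have x0 : 0 < x by exact: le_lt_trans mx.
    have xr : 0 < 1 + x `^ r by rewrite ltr_wpDr ?powR_ge0.
    apply: (@near_eq_is_derive _ _ _ (fun t => t * (1 + t `^ r)^-1)).
      near=> t; have mt : m < t by near: t; exact: lt_nbhsr.
      by rewrite feedbackE// ltW.
    have h1 := @is_deriveD R R R (cst 1) _ x 1 _ _ (is_derive_cst _ _ _) (is_derive_powRr x0).
    have xr0 : 1 + x `^ r != 0 by rewrite gt_eqF.
    have h2 := @is_deriveV R (fun t => 1 + t `^ r) x _ 1 xr0 h1.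
    have h3 := @is_deriveM R R id _ x 1 _ _ (is_derive_id _ _) h2.
    apply: (is_derive_eq h3); rewrite /GRing.scale/= /dfeedback /W (max_idPl (ltW mx)).
    have E : x * x `^ (r - 1) = x `^ r by exact: mulr_powRB1 (ltW x0) r0.
    by move: xr0; rewrite -E => xr0; rewrite add0r; field.
have [->|/Fneq//] := eqVneq y m.
apply: is_derive_glue => //; [exact: continuous_feedback|exact: continuous_dfeedback].
Unshelve. all: by end_near. Qed.

(** The derivative [r * x ^ (r - 1)] is monotone, so it is bounded by its value at [M] if [1 <= r]
    and at [m] otherwise; the sum of the two covers both cases. For [r < 1] this is where [0 < m] is
    needed. *)
Let powR_lipschitz M : exists2 K : R, 0 <= K & forall y z, m <= y -> y <= z -> z <= M ->
  z `^ r - y `^ r <= K * (z - y).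
Proof.
exists (r * (M `^ (r - 1) + m `^ (r - 1))); first by rewrite mulr_ge0 ?addr_ge0 ?powR_ge0// ltW.
move=> y z my yz zM; have y0 : 0 <= y by exact: le_trans my.
have z0 : 0 <= z by exact: le_trans yz.
have [||x] := @MVT_segment R (fun t => Num.max t 0 `^ r) (fun x => r * x `^ (r - 1)) y z yz.
- move=> x; rewrite in_itv/= => /andP[yx xz]; have x0 : 0 < x by exact: le_lt_trans yx.
  apply: (@near_eq_is_derive _ _ _ (fun t : R => t `^ r)); last exact: is_derive_powRr.
  near=> t; have t0 : 0 < t by near: t; exact: lt_nbhsr.
  by rewrite (max_idPl (ltW t0)).
- by apply: continuous_subspaceT; exact: continuous_powR_max.
rewrite in_itv/= => /andP[yx xz]; rewrite (max_idPl y0) (max_idPl z0) => ->.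
rewrite ler_wpM2r ?subr_ge0// ler_wpM2l ?(ltW r0)//.
have x0 : 0 <= x by exact: le_trans yx.
have M0 : 0 <= M by exact: le_trans zM.
have [r1|r1] := leP 1 r.
  rewrite (@le_trans _ _ (M `^ (r - 1)))// ?lerDl ?powR_ge0//.
  by rewrite ge0_ler_powR ?nnegrE ?subr_ge0// (le_trans xz).
have m_gt0 : 0 < m by case: mr => //; rewrite leNgt r1.
rewrite (@le_trans _ _ (m `^ (r - 1)))// ?lerDr ?powR_ge0//.
have x_gt0 : 0 < x by rewrite (lt_le_trans m_gt0)// (le_trans my).
rewrite -opprB !powRN lef_pV2 ?posrE ?powR_gt0// ge0_ler_powR ?nnegrE ?subr_ge0 ?(ltW r1)//.
exact: le_trans my yx.
Unshelve. all: by end_near. Qed.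

(** [dfeedback] is a quadratic polynomial in [W], and [W x - W z] is the difference of the powers
    times [W x * W z], a factor at most 1. *)
Lemma dfeedback_lipschitz M : exists2 K : R, 0 <= K &
  forall x z, `|x| <= M -> `|z| <= M -> `|dfeedback x - dfeedback z| <= K * `|x - z|.
Proof.
have [K K0 KP] := powR_lipschitz (Num.max M m).
exists ((`|1 - r| + 2 * r) * K); first by rewrite mulr_ge0// addr_ge0// mulr_ge0// ltW.
have Wlip x z : x <= z -> `|z| <= M -> `|W x - W z| <= K * (z - x).
  move=> xz zM.
  have xz' : Num.max x m <= Num.max z m by rewrite ge_max !le_max xz lexx orbT.
  have := KP (Num.max x m) (Num.max z m) _ xz' _.
  rewrite le_max lexx orbT => /(_ isT) H.
  have {}H : Num.max z m `^ r - Num.max x m `^ r <= K * (Num.max z m - Num.max x m).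
    by apply: H; rewrite ge_max !le_max lexx orbT (le_trans (ler_norm _) zM).
  have H2 : Num.max z m - Num.max x m <= z - x.
    by rewrite /Num.max; do 2 case: ifPn => //; rewrite -?leNgt; lra.
  have H3 : 0 <= Num.max z m `^ r - Num.max x m `^ r.
    by rewrite subr_ge0 ge0_ler_powR ?nnegrE// ltW.
  rewrite (_ : W x - W z = (Num.max z m `^ r - Num.max x m `^ r) * (W x * W z)); last first.
    by rewrite /W; field; rewrite !gt_eqF.
  have /andP[x0 x1] := W01 x; have /andP[z0 z1] := W01 z.
  rewrite normrM (ger0_norm H3) ger0_norm ?mulr_ge0 ?(ltW x0) ?(ltW z0)//.
  rewrite (@le_trans _ _ (Num.max z m `^ r - Num.max x m `^ r))//.
    by rewrite ler_piMr// mulr_ile1// ltW.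
  by rewrite (le_trans H)// ler_wpM2l.
have {}Wlip x z : `|x| <= M -> `|z| <= M -> `|W x - W z| <= K * `|x - z|.
  move=> xM zM; have [xz|zx] := leP x z.
    by rewrite (distrC x) (ger0_norm (_ : 0 <= z - x)) ?subr_ge0//; exact: Wlip.
  by rewrite distrC (gtr0_norm (_ : 0 < x - z)) ?subr_gt0//; apply: Wlip => //; exact: ltW.
move=> x z xM zM.
rewrite (_ : _ - _ = (W x - W z) * ((1 - r) + r * (W x + W z))); last by rewrite /dfeedback; ring.
have /andP[x0 x1] := W01 x; have /andP[z0 z1] := W01 z.
rewrite normrM mulrC -mulrA; apply: ler_pM => //; last exact: Wlip.
rewrite (le_trans (ler_normD _ _))// lerD2l ger0_norm; last by rewrite mulr_ge0 ?addr_ge0// ltW.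
by rewrite mulrC ler_wpM2r ?(ltW r0)// -[leRHS]/(1 + 1) lerD.
Qed.

End feedback.

(** * Comparison with affine functions *)

Section comparison.
Context {R : realType}.
Notation mu := (@lebesgue_measure R).
Implicit Types (x u z f : R -> R) (a b c e al r s t : R).

Lemma first_touch z t1 : continuous z -> 0 < z 0 -> 0 <= t1 -> z t1 <= 0 ->
  exists t0, [/\ 0 < t0, z t0 = 0 & forall t, 0 <= t < t0 -> 0 < z t].
Proof.
move=> cz z0 t10 zt1.
pose S : set R := [set t | 0 <= t /\ z t <= 0].
have hS : has_inf S by split; [exists t1|exists 0 => t []].
pose t0 := inf S.
have t0S t : S t -> t0 <= t by move=> St; apply: ge_inf => //; case: hS.
have pos t : 0 <= t < t0 -> 0 < z t.
  by move=> /andP[tge tlt]; rewrite ltNge; apply/negP => zt; move: tlt; rewrite ltNge t0S.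
have t00 : 0 <= t0 by apply: lb_le_inf; [case: hS|move=> t []].
have zle : z t0 <= 0.
  rewrite leNgt; apply/negP => zt0.
  have /cvgrPdist_lt/(_ _ zt0)[d /= d0 dP] := cz t0.
  have [s [s0 zs] st] := inf_adherent d0 hS.
  have := dP s; rewrite /= distrC ger0_norm ?subr_ge0 ?t0S// ltrBlDl => /(_ st).
  by rewrite ltr_norml; lra.
have t0_gt0 : 0 < t0.
  by rewrite lt_neqAle t00 andbT; apply/eqP => E; move: zle; rewrite -E leNgt z0.
exists t0; split => //; apply/eqP; rewrite eq_le zle /= leNgt; apply/negP => zt0.
have zt0' : 0 < - z t0 by rewrite oppr_gt0.
have /cvgrPdist_lt/(_ _ zt0')[d /= d0 dP] := cz t0.
pose s := Num.max 0 (t0 - d / 2).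
have s0 : 0 <= s by rewrite le_max lexx.
have st0 : s < t0 by rewrite gt_max t0_gt0 gtrBl divr_gt0.
have zs : 0 < z s by apply: pos; rewrite s0.
have := dP s; rewrite /= ger0_norm ?subr_ge0 ?(ltW st0)// ltrBlDl -ltrBlDr.
have -> : t0 - d < s by rewrite lt_max; apply/orP; right; lra.
by move=> /(_ isT); rewrite ltr_norml; lra.
Qed.

Lemma is_derive_slope z t0 (d : R) e : is_derive t0 1 z d -> 0 < e ->
  exists2 e' : R, 0 < e' & forall t, t != t0 -> `|t - t0| < e' ->
    `|d - (t - t0)^-1 * (z t - z t0)| < e.
Proof.
move=> [dz <-] e0.
have cv : h^-1 *: (z (h *: 1 + t0) - z t0) @[h --> 0^'] --> 'D_1 z t0 by exact: dz.
have /cvgrPdist_lt/(_ _ e0)[e' /= e'0 eP] := cv.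
exists e' => // t tn0 te; have := eP (t - t0); rewrite /= sub0r normrN subr_eq0 => /(_ te tn0).
by rewrite /GRing.scale/= mulr1 subrK.
Qed.

Lemma is_derive_locally_bounded z t0 (d : R) : is_derive t0 1 z d -> z t0 = 0 ->
  exists2 e : R, 0 < e & forall t, t0 - e < t < t0 -> `|z t| <= (`|d| + 1) * (t0 - t).
Proof.
move=> dz z0; have [e e0 eP] := is_derive_slope dz ltr01.
exists e => // t /andP[te tt].
have tn0 : t != t0 by rewrite lt_eqF.
have := eP t tn0; rewrite ltr0_norm ?subr_lt0// opprB z0 subr0 => H.
have {}H : `|d - (t - t0)^-1 * z t| < 1 by apply: H; lra.
have -> : z t = (t - t0) * ((t - t0)^-1 * z t) by rewrite mulVKf// subr_eq0.
rewrite normrM (ltr0_norm (_ : t - t0 < 0)) ?subr_lt0// opprB mulrC ler_wpM2r ?subr_ge0 ?(ltW tt)//.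
rewrite -(subrK d (_ * _)) (le_trans (ler_normD _ _))// addrC lerD2l distrC ltW//.
Qed.

Lemma derive_touch_le0 z t0 (d : R) : is_derive t0 1 z d -> z t0 = 0 -> 0 < t0 ->
  (forall t, 0 <= t < t0 -> 0 <= z t) -> d <= 0.
Proof.
move=> dz z0 t00 zge; rewrite leNgt; apply/negP => d0.
have [e e0 eP] := is_derive_slope dz d0.
pose t := Num.max 0 (t0 - e / 2).
have tge : 0 <= t by rewrite le_max lexx.
have tlt : t < t0 by rewrite gt_max t00 gtrBl divr_gt0.
have te : t0 - t < e by rewrite ltrBlDl -ltrBlDr lt_max; apply/orP; right; lra.
have tn0 : t != t0 by rewrite lt_eqF.
have := eP t tn0; rewrite ltr0_norm ?subr_lt0// opprB z0 subr0 => /(_ te).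
have zt : 0 <= z t by apply: zge; rewrite tge.
have : (t - t0)^-1 * z t <= 0 by rewrite mulr_le0_ge0// invr_le0 subr_le0 ltW.
by move=> H; rewrite ltr_norml; lra.
Qed.

(** Integration by parts, with the kernel [k] increasing: [Z - k * z] has derivative
    [- k' * z <= 0], whence [Z t <= k t * z t] for [t < t0]. As [z] vanishes at [t0] and is
    differentiable there, [k * z] is of order [(t0 - t) ^ (1 - al)] and tends to 0. *)
Lemma weighted_touch_le0 al z (d : R -> R) t0 : 0 < al < 1 -> 0 < t0 ->
  (forall t, 0 < t -> is_derive t 1 z (d t)) -> (forall t, 0 < t -> {for t, continuous d}) ->
  z t0 = 0 -> (forall t, 0 <= t < t0 -> 0 <= z t) ->
  mu.-integrable `[0, t0] (EFin \o (fun s => (t0 - s) `^ (- al) * d s)) ->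
  \int[mu]_(s in `[0, t0]) ((t0 - s) `^ (- al) * d s) <= 0.
Proof.
move=> /andP[al0 al1] t00 dz cd z0 zge fi.
pose k s := (t0 - s) `^ (- al).
pose f s := k s * d s.
pose Z t := \int[mu]_(s in `[0, t]) f s.
have cZ : {within `[0, t0], continuous Z}.
  exact: (parameterized_integral_continuous (ltW t00) fi).
have Z0 : Z 0 = 0 by rewrite /Z set_itv1 Rintegral_set1.
have dk s : s < t0 -> is_derive s 1 k (al * (t0 - s) `^ (- al - 1)).
  move=> st; have st0 : 0 < t0 - s by rewrite subr_gt0.
  have h1 := @is_deriveB R R R (cst t0) id s 1 0 1 (is_derive_cst _ _ _) (is_derive_id _ _).
  have h2 := @is_derive1_comp R (fun t => t `^ (- al)) (fun s => t0 - s) s _ _ (is_derive1_powR (- al) st0) h1.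
  by apply: (is_derive_eq h2); ring.
have ck s : s < t0 -> {for s, continuous k}.
  by move=> /dk[/derivable1_diffP/differentiable_continuous].
have dZ t : 0 < t < t0 -> is_derive t 1 Z (f t).
  move=> /andP[tge tlt].
  have cf : {for t, continuous f} by apply: cvgM; [exact: ck|exact: cd].
  have [Zd Zf] := continuous_FTC1_closed tlt fi tge cf.
  have <- : derive1 Z t = f t := Zf.
  by rewrite derive1E; exact: derivableP.
have dPhi t : 0 < t < t0 -> is_derive t 1 (fun t => Z t - k t * z t) (- (al * (t0 - t) `^ (- al - 1) * z t)).
  move=> t0t; have /andP[tge tlt] := t0t.
  have h1 := @is_deriveM R R k z t 1 _ _ (dk t tlt) (dz t tge).
  have h2 := @is_deriveB R R R _ _ t 1 _ _ (dZ t t0t) h1.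
  by apply: (is_derive_eq h2); rewrite /GRing.scale/= /f; ring.
have decr b c : 0 < b -> b <= c -> c < t0 -> Z c - k c * z c <= Z b - k b * z b.
  move=> b0 bc ct.
  apply: (@ler0_derive1_nincr R (fun t => Z t - k t * z t) b c) => //.
  - move=> s; rewrite in_itv/= => /andP[bs sc].
    by have [] := dPhi s _; rewrite ?(lt_trans b0 bs) ?(lt_trans sc ct).
  - move=> s; rewrite in_itv/= => /andP[bs sc]; rewrite derive1E.
    have st : 0 < s < t0 by rewrite (lt_trans b0 bs) (lt_trans sc ct).
    have [_ ->] := dPhi s st.
    rewrite oppr_le0 mulr_ge0 ?mulr_ge0 ?powR_ge0 ?(ltW al0)//; apply: zge.
    by rewrite (ltW (lt_trans b0 bs)) (lt_trans sc ct).
  - apply: derivable_within_continuous => s; rewrite in_itv/= => /andP[bs sc].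
    by have [] := dPhi s _; rewrite ?(lt_le_trans b0 bs) ?(le_lt_trans sc ct).
have /(continuous_within_itvP _ t00)[_ Zright Zleft] := cZ.
(* The derivative of [z] is given only at positive times, so [decr] starts at some [b > 0], and [b]
   is sent to 0 using the continuity of [Z]. *)
have Zle t : 0 < t < t0 -> Z t <= k t * z t.
  move=> /andP[tge tlt]; rewrite -subr_le0; apply/ler_addgt0Pr => e e0; rewrite add0r.
  have /cvgrPdist_lt/(_ _ e0)[c /= c0 cP] := Zright.
  pose b := Num.min (c / 2) (t / 2).
  have b0 : 0 < b by rewrite lt_min !divr_gt0.
  have bc : b < c by rewrite gt_min; apply/orP; left; lra.
  have bt : b <= t by rewrite ge_min; apply/orP; right; lra.
  have := cP b; rewrite /= sub0r normrN gtr0_norm// Z0 sub0r normrN => /(_ bc b0) Zb.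
  rewrite (le_trans (decr b t b0 bt tlt))// (le_trans _ (ltW Zb))// (le_trans _ (ler_norm _))//.
  rewrite gerBl mulr_ge0 ?powR_ge0// zge// (ltW b0) (le_lt_trans bt)//.
have [e e0 eP] := is_derive_locally_bounded (dz t0 t00) z0.
rewrite leNgt; apply/negP => Zpos.
have Z2 : 0 < Z t0 / 2 by rewrite divr_gt0.
have /cvgrPdist_lt/(_ _ Z2)[c /= c0 cP] := Zleft.
pose K : R := `|d t0| + 1.
have K0 : 0 < K by rewrite ltr_wpDl.
(* The length at which the bound [K * h ^ (1 - al)] on [k * z] equals [Z t0 / 2]. A smaller step
   contradicts [Z] being above [Z t0 / 2] near [t0]. *)
pose rho := (Z t0 / (2 * K)) `^ ((1 - al)^-1).
have q0 : 0 < Z t0 / (2 * K) by rewrite divr_gt0// mulr_gt0.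
have rho0 : 0 < rho by rewrite powR_gt0.
have al10 : 0 < 1 - al by rewrite subr_gt0.
have rhoE : rho `^ (1 - al) = Z t0 / (2 * K).
  by rewrite -powRrM mulVf ?gt_eqF// powRr1// ltW.
pose h := Num.min (Num.min (c / 2) (e / 2)) (Num.min (t0 / 2) rho).
have h0 : 0 < h by rewrite !lt_min !divr_gt0.
have hc : h < c by rewrite !gt_min; apply/orP; left; apply/orP; left; lra.
have he : h < e by rewrite !gt_min; apply/orP; left; apply/orP; right; lra.
have ht : h < t0 by rewrite !gt_min; apply/orP; right; apply/orP; left; lra.
have hr : h <= rho by rewrite !ge_min lexx !orbT.
pose t := t0 - h.
have tt : 0 < t < t0 by rewrite /t subr_gt0 ht gtrBl.
have th : t0 - t = h by rewrite /t; ring.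
have Zt : Z t0 / 2 < Z t.
  have := cP t; rewrite /= th gtr0_norm// => /(_ hc).
  by case/andP: tt => _ -> /(_ isT); rewrite ltr_norml; lra.
move: Zt; rewrite ltNge => /negP; apply; apply: (le_trans (Zle _ tt)).
have zt : z t <= K * h.
  rewrite -th; apply: (le_trans (ler_norm _)); apply: eP.
  by case/andP: tt => _ ->; rewrite /t ltrD2l ltrN2 he.
apply: (@le_trans _ _ (h `^ (- al) * (K * h))).
  by rewrite /k th ler_wpM2l ?powR_ge0.
rewrite (_ : h `^ (- al) * (K * h) = K * h `^ (1 - al)); last first.
  by rewrite powRD ?(gt_eqF h0) ?implybT// powRr1 ?(ltW h0)//; ring.
rewrite (_ : Z t0 / 2 = K * (Z t0 / (2 * K))); last by field; rewrite gt_eqF.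
by rewrite ler_pM2l// -rhoE ge0_ler_powR ?nnegrE ?(ltW al10) ?(ltW h0) ?(ltW rho0).
Qed.

(** The factor for which [touch_const al * t ^ (1 - al)] is the Caputo derivative of the identity;
    classically [1 / Gamma (2 - al)]. *)
Definition touch_const al : R := if al == 1 then 1 else
  (Gamma (1 - al))^-1 * \int[mu]_(s in `]0, 1[) beta_weight (1 - al) 1 s.

Lemma touch_const_ge0 al : 0 <= touch_const al.
Proof.
rewrite /touch_const; case: ifPn => // _; rewrite mulr_ge0 ?invr_ge0//; apply: Rintegral_ge0 => s _.
  by rewrite mulr_ge0 ?powR_ge0 ?expR_ge0.
exact: beta_weight_ge0.
Qed.

(** Subtracting the affine function leaves a nonnegative [z] that vanishes at [t0]. Its Caputo
    derivative there is at most 0, by the sign of left difference quotients if [al = 1] and by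
    [weighted_touch_le0] otherwise. *)
Lemma caputo_touch al x u t0 y b c : 0 < al <= 1 -> 0 < t0 ->
  (forall t, 0 < t -> is_derive t 1 x (u t)) -> (forall t, 0 < t -> {for t, continuous u}) ->
  has_caputo al x t0 y -> x t0 = b + c * t0 ->
  (forall t, 0 <= t < t0 -> b + c * t <= x t) ->
  y <= c * (touch_const al * t0 `^ (1 - al)).
Proof.
move=> /andP[al0 al1] t00 dx cu cap xt0 xge.
pose z t := x t - (b + c * t).
have dline t : is_derive t 1 (fun t : R => b + c * t) c.
  have h := @is_deriveD R R R (cst b) _ t 1 _ _ (is_derive_cst _ _ _) (@is_deriveZ R R R id c t 1 _ (is_derive_id _ _)).
  by apply: (is_derive_eq h); rewrite add0r /GRing.scale/= mulr1.
have dz t (d : R) : is_derive t 1 x d -> is_derive t 1 z (d - c).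
  by move=> h; exact: (@is_deriveB R R R _ _ t 1 _ _ h (dline t)).
have z0 : z t0 = 0 by rewrite /z xt0 subrr.
have zge t : 0 <= t < t0 -> 0 <= z t by move=> h; rewrite subr_ge0; exact: xge.
move: cap; rewrite /has_caputo /touch_const; case: ifPn => [/eqP -> dxy|al_neq1 [_ ki yE]].
  rewrite subrr powRr0 !mulr1 -subr_le0.
  exact: (derive_touch_le0 (dz _ _ dxy)).
have al_lt1 : al < 1 by rewrite lt_neqAle al_neq1.
have nal : 0 < 1 - al <= 1 by lra.
pose k s := (t0 - s) `^ (- al).
have ioo : mu.-integrable `]0, t0[ (EFin \o (fun s => k s * derive1 x s)).
  by apply: (@integrableS _ _ _ mu `[0, t0]) => //; exact: subset_itv_oo_cc.
have kE s : (t0 - s) `^ (1 - al - 1) * s `^ (1 - 1) * 1 = k s.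
  by rewrite subrr powRr0 !mulr1 /k; congr (_ `^ _); ring.
have l01 : 0 < (1 : R) <= 1 by rewrite ltr01 lexx.
have cone : continuous (fun _ : R => 1 : R) by move=> ?; exact: cvg_cst.
have ik : mu.-integrable `]0, t0[ (EFin \o k).
  have := @integrable_conv R (1 - al) 1 (fun=> 1) t0 nal l01 cone t00.
  by apply: eq_integrable => // s _; rewrite /= kE.
have kI : \int[mu]_(s in `]0, t0[) k s = t0 `^ (1 - al) * \int[mu]_(s in `]0, 1[) beta_weight (1 - al) 1 s.
  transitivity (\int[mu]_(s in `]0, t0[) ((t0 - s) `^ (1 - al - 1) * s `^ (1 - 1) * 1)).
    by apply: eq_Rintegral => s _; rewrite kE.
  rewrite (@Rintegral_conv R (1 - al) 1 (fun=> 1) t0 nal l01 cone t00) addrK; congr (_ * _).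
  by apply: eq_Rintegral => s _; exact: mulr1.
have E s : 0 < s < t0 -> k s * derive1 x s + - c * k s = k s * (u s - c).
  by move=> /andP[s0 _]; rewrite derive1E; have [_ ->] := dx s s0; ring.
have ioz : mu.-integrable `]0, t0[ (EFin \o (fun s => k s * (u s - c))).
  have := @integrableDR _ _ _ mu `]0, t0[ _ _ (measurable_itv _) ioo
    (@integrableZR _ _ _ mu `]0, t0[ _ (- c) (measurable_itv _) ik).
  by apply: eq_integrable => // s; rewrite inE/= in_itv/= => st; rewrite E.
have cd t : 0 < t -> {for t, continuous (fun s => u s - c)}.
  by move=> tge; apply: cvgB; [exact: cu|exact: cvg_cst].
have al01 : 0 < al < 1 by rewrite al0.
have := @weighted_touch_le0 al z (fun s => u s - c) t0 al01 t00 (fun t tge => dz t _ (dx t tge)) cd z0 zge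
  (integrable_oo_cc ioz).
rewrite Rintegral_oo_cc//.
have -> : \int[mu]_(s in `]0, t0[) (k s * (u s - c)) = \int[mu]_(s in `]0, t0[) (k s * derive1 x s + - c * k s).
  by apply: eq_Rintegral => s; rewrite inE/= in_itv/= => st; rewrite E.
rewrite RintegralD//; last exact: integrableZR.
rewrite RintegralZl// kI => H.
have G0 : 0 < Gamma (1 - al) by exact: Gamma_gt0.
rewrite yE Rintegral_oo_cc//.
rewrite (_ : c * _ = (Gamma (1 - al))^-1 * (c * (t0 `^ (1 - al) * \int[mu]_(s in `]0, 1[) beta_weight (1 - al) 1 s))); last by ring.
by rewrite ler_wpM2l ?invr_ge0 ?(ltW G0)//; move: H; rewrite mulNr subr_le0.
Qed.

End comparison.

(** * Instability of the zero equilibrium *)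

Section mackey_glass.
Context {R : realType}.
Notation mu := (@lebesgue_measure R).
Implicit Types (x u z f phi : R -> R) (a b c e al r s t p q tau m y w : R).

Lemma rpowE y r : 0 <= y -> rpow y r = y `^ r.
Proof.
move=> y0; rewrite /rpow; case: ifPn => // rn.
by rewrite -powR_mulrn// Num.Theory.truncnK.
Qed.

Lemma feedback_defined_ge0 r y : 0 <= y -> feedback_defined r y.
Proof.
move=> y0; split; first by right.
by rewrite rpowE// gt_eqF// ltr_wpDr// powR_ge0.
Qed.

Lemma zero_equilibrium al p q r tau : is_equilibrium al p q r tau 0.
Proof.
split => // [|t t0]; first by apply: continuous_subspaceT => s; exact: cvg_cst.
split; first exact: feedback_defined_ge0.
rewrite /= mulr0 add0r mul0r mulr0 /has_caputo; case: ifPn => _; first exact: is_derive_cst.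
have kE : (fun s => (t - s) `^ (- al) * derive1 (cst (0 : R)) s) = cst 0.
  by apply/funext => s; rewrite derive1_cst mulr0.
rewrite kE; split.
- move=> e e0; exists 1 => // n u v _ _ _; rewrite big1// => i _.
  by rewrite subrr normr0.
- by rewrite (_ : EFin \o cst 0 = cst 0%E)//; exact: integrable0.
- by rewrite Rintegral_cst// mul0r mulr0.
Qed.

(** The threshold [s] solves [D * s ^ al = c]: below it the power is at most its value at [s], above
    it the linear term dominates. *)
Lemma powR_sublinear al c (D : R) : 0 < al <= 1 -> 0 <= c -> 0 < D ->
  exists2 A : R, 0 <= A & forall t, 0 < t -> c * t `^ (1 - al) <= A + D * t.
Proof.
move=> /andP[al0 al1] c0 D0; pose s := (c / D) `^ (al^-1).
have s0 : 0 <= s by exact: powR_ge0.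
exists (c * s `^ (1 - al)); first by rewrite mulr_ge0 ?powR_ge0.
move=> t t0; have [ts|st] := leP t s.
  rewrite (@le_trans _ _ (c * s `^ (1 - al)))//; last by rewrite lerDl mulr_ge0// ltW.
  by rewrite ler_wpM2l// ge0_ler_powR ?nnegrE ?subr_ge0// ltW.
rewrite (@le_trans _ _ (D * t))//; last by rewrite lerDr mulr_ge0 ?powR_ge0.
have cD : c / D <= t `^ al.
  rewrite (_ : c / D = s `^ al); first by rewrite ge0_ler_powR ?nnegrE ?(ltW al0) ?s0 ?(ltW t0) ?(ltW st).
  by rewrite /s -powRrM mulVf ?gt_eqF// powRr1// divr_ge0// ltW.
have -> : D * t = D * t `^ al * t `^ (1 - al).
  by rewrite -mulrA -powRD ?(gt_eqF t0) ?implybT// addrC subrK powRr1// ltW.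
by rewrite ler_wpM2r ?powR_ge0// mulrC -ler_pdivrMr.
Qed.

(** [q / (1 + y ^ r) >= q1] amounts to [y ^ r <= (q - q1) / q1], which fixes [e]. *)
Lemma feedback_linear_bound q q1 r : 0 < q1 -> q1 < q -> 0 < r ->
  exists2 e : R, 0 < e & forall y, 0 <= y <= e -> q1 * y <= q * (y / (1 + y `^ r)).
Proof.
move=> q10 qq1 r0; pose d := (q - q1) / q1.
have d0 : 0 < d by rewrite divr_gt0 ?subr_gt0.
exists (d `^ r^-1); first exact: powR_gt0.
move=> y /andP[y0 yd].
have yr : y `^ r <= d.
  have -> : d = (d `^ r^-1) `^ r by rewrite -powRrM mulVf ?gt_eqF// powRr1// ltW.
  by rewrite ge0_ler_powR ?nnegrE ?powR_ge0 ?(ltW r0).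
have W0 : 0 < 1 + y `^ r by rewrite ltr_wpDr// powR_ge0.
rewrite mulrA ler_pdivlMr// mulrAC ler_wpM2r//.
have : q1 * y `^ r <= q1 * d by rewrite ler_wpM2l// ltW.
by rewrite /d mulrC (mulrC q1) divfK ?gt_eqF//; lra.
Qed.

(** After clearing denominators the claim is [m * y ^ r <= y * m ^ r]; writing
    [w = w ^ r * w ^ (1 - r)] reduces it to monotonicity of [w ^ (1 - r)]. *)
Lemma feedback_nondecreasing r m y : 0 < r <= 1 -> 0 < m -> m <= y ->
  m / (1 + m `^ r) <= y / (1 + y `^ r).
Proof.
move=> /andP[r0 r1] m0 my; have y0 : 0 < y by exact: lt_le_trans my.
have W0 w : 0 < 1 + w `^ r by rewrite ltr_wpDr// powR_ge0.
rewrite ler_pdivrMr// mulrAC ler_pdivlMr// !mulrDr !mulr1 lerD//.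
have E w : 0 < w -> w = w `^ r * w `^ (1 - r).
  by move=> w0; rewrite -powRD ?(gt_eqF w0) ?implybT// addrC subrK powRr1// ltW.
have ab : m `^ (1 - r) <= y `^ (1 - r).
  by rewrite ge0_ler_powR ?nnegrE ?subr_ge0 ?(ltW m0) ?(ltW y0).
rewrite [X in X * _ <= _](E m m0) [X in _ <= X * _](E y y0) mulrAC [leRHS]mulrAC.
by rewrite (mulrC (y `^ r) (m `^ r)) ler_wpM2l// mulr_ge0 ?powR_ge0.
Qed.

(** A parabola continued by the constant [c]: it is C^1 with derivative 0 from time 0 on, and [K] is
    free to prescribe the value at [- tau]. *)
Definition history c K t : R := c - K * (Num.min t 0 * Num.min t 0).

Definition dhistory K t : R := - (2 * K * Num.min t 0).

Lemma continuous_min0 : continuous (fun t : R => Num.min t 0).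
Proof. by move=> t; apply: continuous_min; [exact: cvg_id|exact: cvg_cst]. Qed.

Lemma is_derive_history c K t : is_derive t 1 (history c K) (dhistory K t).
Proof.
have cdh : continuous (dhistory K).
  by move=> s; apply: cvgN; apply: cvgM; [exact: cvg_cst|exact: continuous_min0].
have ch : continuous (history c K).
  move=> s; apply: cvgB; first exact: cvg_cst.
  by apply: cvgM; [exact: cvg_cst|apply: cvgM; exact: continuous_min0].
have dneq s : s != 0 -> is_derive s 1 (history c K) (dhistory K s).
  rewrite neq_lt => /orP[s0|s0].
    apply: (@near_eq_is_derive _ _ _ (fun t => c - K * (t * t))).
      near=> x; have x0 : x < 0 by near: x; exact: lt_nbhsl.
      by rewrite /history (min_idPl (ltW x0)).
    have h1 := @is_deriveM R R id id s 1 _ _ (is_derive_id _ _) (is_derive_id _ _).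
    have h2 := @is_deriveB R R R (cst c) _ s 1 _ _ (is_derive_cst _ _ _) (@is_deriveZ R R R _ K s 1 _ h1).
    apply: (is_derive_eq h2); rewrite /GRing.scale/= /dhistory (min_idPl (ltW s0)); ring.
  apply: (@near_eq_is_derive _ _ _ (cst c)).
    near=> x; have x0 : 0 < x by near: x; exact: lt_nbhsr.
    by rewrite /history (min_idPr (ltW x0)) !mulr0 subr0.
  by apply: (is_derive_eq (is_derive_cst _ _ _)); rewrite /dhistory (min_idPr (ltW s0)) mulr0 oppr0.
have [->|] := eqVneq t 0; last exact: dneq.
apply: is_derive_glue => //; exact: cdh.
Unshelve. all: by end_near. Qed.

Section instability.
Variables (al p q q1 r tau e y0 : R).
Hypotheses (al01 : 0 < al <= 1) (p0 : 0 < p) (pq1 : p < q1) (q1q : q1 < q).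
Hypotheses (r0 : 0 < r) (tau0 : 0 <= tau) (y00 : 0 < y0) (qy0 : q * y0 < p * e).
Hypothesis linear_bound : forall y, 0 <= y <= e -> q1 * y <= q * (y / (1 + y `^ r)).

Let q10 : 0 < q1. Proof. exact: lt_trans pq1. Qed.

Let q0 : 0 < q. Proof. exact: lt_trans q1q. Qed.

Let y0e : y0 < e.
Proof.
rewrite -(ltr_pM2l p0); apply: le_lt_trans qy0; rewrite ler_wpM2r ?(ltW y00)//.
exact: ltW (lt_trans pq1 q1q).
Qed.

(** The value at time 0 for which the right-hand side vanishes when the delayed value is [y0]. *)
Let c := q * (y0 / (1 + y0 `^ r)) / p.

Let cy0 : y0 <= c.
Proof.
rewrite /c ler_pdivlMr// (le_trans _ (linear_bound _)) ?(ltW y00) ?(ltW y0e)//.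
by rewrite mulrC ler_wpM2r ?(ltW y00) ?(ltW pq1).
Qed.

Let history_top_lt d : q * y0 < p * d -> c < d.
Proof.
move=> qd; rewrite /c ltr_pdivrMr// mulrC [ltRHS]mulrC; apply: le_lt_trans qd.
rewrite mulrC ler_wpM2l ?(ltW q0)// ler_pdivrMr ?ler_peMr ?(ltW y00) ?lerDl ?powR_ge0//.
by rewrite ltr_wpDr ?powR_ge0.
Qed.

Let ce : c < e. Proof. exact: history_top_lt. Qed.

(** Makes the history equal to [y0] at [- tau]. For [tau = 0] the division by zero yields [K = 0], a
    constant history. *)
Let K := (c - y0) / (tau * tau).

Let phi := history c K.

Let phi_bounds t : - tau <= t <= 0 -> y0 <= phi t <= c.
Proof.
move=> /andP[tt t0]; rewrite /phi /history (min_idPl t0).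
have K0 : 0 <= K by rewrite divr_ge0 ?mulr_ge0 ?subr_ge0.
have t2 : t * t <= tau * tau by nra.
have Kt : 0 <= K * (t * t) by rewrite mulr_ge0// -expr2 sqr_ge0.
have : K * (t * t) <= K * (tau * tau) by rewrite ler_wpM2l.
have : K * (tau * tau) <= c - y0.
  have [tau_eq0|tau_neq0] := eqVneq tau 0; first by rewrite tau_eq0 !mulr0 subr_ge0.
  by rewrite /K divfK// mulf_neq0.
lra.
Qed.

Let phi0 : phi 0 = c. Proof. by rewrite /phi /history minxx !mulr0 subr0. Qed.

Let phi_tau : 0 < tau -> phi (- tau) = y0.
Proof.
move=> tau_gt0; rewrite /phi /history (min_idPl _) ?oppr_le0// mulrNN /K divfK ?mulf_neq0 ?gt_eqF//.
by rewrite opprB addrC subrK.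
Qed.

(** If [r < 1], the power is not Lipschitz at 0, so [m] must be positive; the feedback is then
    monotone and a delayed value above [m] is good enough. If [tau = 0], the delayed value at a
    touch is [m] itself, and the right-hand side is positive only for [m > 0]. Otherwise the
    feedback may decrease at large arguments, but at level 0 any positive delayed value suffices. *)
Let m := if (tau == 0) || (r < 1) then y0 / 2 else 0.

Let m0 : 0 <= m. Proof. by rewrite /m; case: ifPn => // _; rewrite divr_ge0// ltW. Qed.

Let my0 : m < y0. Proof. by rewrite /m; case: ifPn => // _; have := y00; lra. Qed.

Let mr : 0 < m \/ 1 <= r.
Proof.
rewrite /m; case: ifPn => [_|]; first by left; rewrite divr_gt0.
by rewrite negb_or => /andP[_]; rewrite -leNgt; right.
Qed.

Let F := feedback r m.

Lemma small_history_solution : exists x u, [/\ continuous x, forall t, 0 < t -> is_derive t 1 x (u t),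
  forall t, 0 < t -> {for t, continuous u}, is_solution al p q r tau phi x &
  forall t, - tau <= t -> 0 <= x t].
Proof.
have dphi_continuous : continuous (dhistory K).
  by move=> s; apply: cvgN; apply: cvgM; [exact: cvg_cst|exact: continuous_min0].
have dphi0 t : 0 <= t -> dhistory K t = 0.
  by move=> t0; rewrite /dhistory (min_idPr t0) mulr0 oppr0.
pose a := if tau == 0 then al else 1.
have a01 : 0 < a <= 1 by rewrite /a; case: ifPn => // _; rewrite ltr01 lexx.
have compat : (tau = 0 /\ a = al) \/ (0 < tau /\ a = 1 /\ - p * phi 0 + q * F (phi (- tau)) = 0).
  rewrite /a; have [tau_eq0|tau_neq0] := eqVneq tau 0; [by left|right].
  have tau_gt0 : 0 < tau by rewrite lt_neqAle eq_sym tau_neq0.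
  split => //; split => //; rewrite phi0 phi_tau// /F feedbackE ?(ltW my0)//.
  by rewrite /c mulNr mulrC divfK ?gt_eqF// addNr.
have [x [u [cx xphi dx cu capx]]] := delay_solution al01 a01 tau0 (is_derive_feedback r0 m0)
  (@continuous_dfeedback R r m r0 m0) (dfeedback_bounded m r0) (dfeedback_lipschitz r0 m0 mr)
  (is_derive_history c K) dphi_continuous dphi0 compat.
have xhist t : - tau <= t -> t <= 0 -> y0 <= x t.
  by move=> tt t0; rewrite xphi//; case/andP: (@phi_bounds t (introT andP (conj tt t0))).
have xm t : - tau <= t -> m <= x t.
  move=> tt; have [t0|t0] := leP t 0; first by rewrite (le_trans (ltW my0))// xhist.
  rewrite leNgt; apply/negP => xtm.
  have [||||t1 [t10 xt1 xgt]] := @first_touch R (fun s => x s - m) t.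
  - by move=> s; apply: cvgB; [exact: cx|exact: cvg_cst].
  - by rewrite subr_gt0 xphi// -/phi phi0 (lt_le_trans my0).
  - exact: ltW.
  - by rewrite subr_le0 ltW.
  (* The barrier has slope 0, so at a touch the right-hand side would be at most 0. The rest shows
     that it is positive. *)
  have xge s : 0 <= s < t1 -> m + 0 * s <= x s.
    by move=> /xgt; rewrite subr_gt0 mul0r addr0 => /ltW.
  have xE : x t1 = m + 0 * t1 by rewrite mul0r addr0; apply/eqP; rewrite -subr_eq0 xt1.
  have := caputo_touch al01 t10 dx cu (capx _ t10) xE xge; rewrite mul0r leNgt => /negP; apply.
  set w := x (t1 - tau).
  have xt1' : x t1 = m by rewrite xE mul0r addr0.
  have w0 : 0 < tau -> m < w.
    move=> tau_gt0; have [tt1|tt1] := ltP (t1 - tau) 0.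
      by apply: (lt_le_trans my0); apply: xhist; [rewrite -[leLHS]add0r lerD2r ltW|exact: ltW].
    by rewrite -subr_gt0; apply: xgt; rewrite tt1/= gtrBl.
  have W0 y : 0 < 1 + y `^ r by rewrite ltr_wpDr// powR_ge0.
  have Fm : 0 < m -> p * m < q * (m / (1 + m `^ r)).
    move=> m_gt0; rewrite (lt_le_trans _ (linear_bound _)) ?m0 ?(ltW (lt_trans my0 y0e))//.
    by rewrite ltr_pM2r.
  rewrite xt1' mulNr addrC subr_gt0 /F.
  have [tau_eq0|tau_neq0] := eqVneq tau 0.
    have -> : w = m by rewrite /w tau_eq0 subr0.
    by rewrite feedbackE//; apply: Fm; rewrite /m tau_eq0 eqxx divr_gt0.
  have mw : m < w by apply: w0; rewrite lt_neqAle eq_sym tau_neq0.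
  rewrite feedbackE ?(ltW mw)//; have [r1|r1] := ltP r 1.
    have m_gt0 : 0 < m by rewrite /m r1 orbT divr_gt0.
    rewrite (lt_le_trans (Fm m_gt0))// ler_wpM2l ?(ltW q0)//.
    by apply: feedback_nondecreasing; rewrite ?r0 ?(ltW r1)// ltW.
  have mE : m = 0 by rewrite /m (negbTE tau_neq0) ltNge r1.
  by rewrite {1}mE mulr0 mulr_gt0// divr_gt0// -mE.
exists x, u; split => //; last by move=> t tt; exact: le_trans (xm t tt).
split.
- by move=> t /andP[_ t0]; rewrite xphi.
- exact: continuous_subspaceT.
- move=> t t0; have xt : m <= x (t - tau) by apply: xm; rewrite lerBrDl subrr ltW.
  have xt0 : 0 <= x (t - tau) by exact: le_trans xt.
  split; first exact: feedback_defined_ge0.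
  by rewrite rpowE// -(feedbackE r xt); exact: capx.
Qed.

Lemma small_history_escape x u : continuous x -> (forall t, 0 < t -> is_derive t 1 x (u t)) ->
  (forall t, 0 < t -> {for t, continuous u}) -> is_solution al p q r tau phi x ->
  (forall t, - tau <= t -> 0 <= x t) -> exists2 t, 0 <= t & e <= x t.
Proof.
move=> cx dx cu [xphi _ capx] xge0.
have [//|nex] := pselect (exists2 t, 0 <= t & e <= x t).
have xe t : 0 <= t -> x t < e.
  by move=> t0; rewrite ltNge; apply/negP => ext; apply: nex; exists t.
have D0 : 0 < q1 - p by rewrite subr_gt0.
have [A A0 AP] := powR_sublinear al01 (touch_const_ge0 al) D0.
(* At a touch, the right-hand side is at least [q1 * m1 * (1 + d * (t1 - tau)) - p * m1 * (1 + d *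
   t1)], and the Caputo derivative is at most [m1 * d * (A + (q1 - p) * t1)]. The slope [q1 - p]
   given to [powR_sublinear] makes the terms in [t1] cancel; what remains is
   [q1 - p <= d * (A + q1 * tau)], excluded by this [d]. *)
pose d := (q1 - p) / (2 * (A + q1 * tau + 1)).
have S0 : 0 < A + q1 * tau + 1 by rewrite ltr_wpDl// addr_ge0// mulr_ge0// ltW.
have d0 : 0 < d by rewrite divr_gt0// mulr_gt0.
have dS : d * (A + q1 * tau) < q1 - p.
  have dE : d * (A + q1 * tau + 1) = (q1 - p) / 2 by rewrite /d; field; rewrite gt_eqF.
  by move: dE; rewrite mulrDr mulr1; lra.
(* Strictly below the whole history, so the barrier starts below [x] and also lies below every
   delayed value taken from the history. *)
pose m1 := y0 / 2.
have m10 : 0 < m1 by rewrite divr_gt0.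
have m1y0 : m1 < y0 by rewrite /m1; have := y00; lra.
have xhist t : - tau <= t -> t <= 0 -> y0 <= x t <= c.
  by move=> tt t0; rewrite xphi ?tt//; apply: phi_bounds; rewrite tt.
have x0 : x 0 = c by rewrite xphi ?phi0// oppr_le0 tau0 lexx.
have xbar t : 0 <= t -> m1 + m1 * d * t < x t.
  move=> t0; rewrite ltNge; apply/negP => xtb.
  have [||||t1 [t10 xt1 xgt]] := @first_touch R (fun s => x s - (m1 + m1 * d * s)) t.
  - move=> s; apply: cvgB; first exact: cx.
    by apply: cvgD; [exact: cvg_cst|apply: cvgM; [exact: cvg_cst|exact: cvg_id]].
  - by rewrite mulr0 addr0 x0 subr_gt0 (lt_le_trans m1y0).
  - exact: t0.
  - by rewrite subr_le0.
  have xge s : 0 <= s < t1 -> m1 + m1 * d * s <= x s.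
    by move=> /xgt; rewrite subr_gt0 => /ltW.
  have xE : x t1 = m1 + m1 * d * t1 by apply/eqP; rewrite -subr_eq0 xt1.
  have [_ cap1] := capx t1 t10.
  have := caputo_touch al01 t10 dx cu cap1 xE xge.
  set w := x (t1 - tau).
  have tt1 : - tau <= t1 - tau by rewrite -[leLHS]add0r lerD2r ltW.
  have w0 : 0 <= w by exact: xge0.
  have we : w <= e.
    have [h|h] := leP (t1 - tau) 0; last by rewrite ltW// xe// ltW.
    by have /andP[_ wc] := xhist _ tt1 h; rewrite (le_trans wc)// ltW.
  have wb : m1 + m1 * d * (t1 - tau) <= w.
    have [h|h] := leP (t1 - tau) 0.
      have /andP[wy _] := xhist _ tt1 h; rewrite (le_trans _ wy)// (le_trans _ (ltW m1y0))//.
      by rewrite gerDl mulr_ge0_le0// mulr_ge0// ltW.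
    have [tau_gt0|] := ltP 0 tau; first by apply: xge; rewrite (ltW h) gtrBl.
    by move=> tau_le0; rewrite /w (_ : tau = 0) ?subr0 ?xE//; apply/eqP; rewrite eq_le tau_le0.
  rewrite rpowE// xE leNgt => /negP; apply.
  have wq : q1 * (m1 + m1 * d * (t1 - tau)) <= q * (w / (1 + w `^ r)).
    by rewrite (le_trans _ (linear_bound _)) ?w0// ler_wpM2l// ltW.
  have := AP t1 t10; have md0 : 0 < m1 * d by rewrite mulr_gt0.
  move: (touch_const al * _) => y yA.
  have {}yA : m1 * d * y <= m1 * (d * A) + (q1 - p) * (m1 * d * t1).
    apply: (le_trans (ler_wpM2l (ltW md0) yA)); rewrite le_eqVlt; apply/orP; left; apply/eqP; ring.
  have {}dS : m1 * (d * (A + q1 * tau)) < m1 * (q1 - p) by rewrite ltr_pM2l.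
  move: dS wq yA; rewrite !mulrDr !mulrDl !mulrN !mulNr; lra.
(* At time [e / (m1 * d)] the barrier has the value [m1 + e], above the level [e] that [x] was
   assumed not to reach. *)
have te : 0 <= e / (m1 * d).
  by apply/ltW/divr_gt0; [exact: lt_trans y0e|exact: mulr_gt0].
have teE : m1 * d * (e / (m1 * d)) = e by rewrite mulrC divfK// gt_eqF// mulr_gt0.
have := xbar _ te; have := xe _ te; rewrite teE => h1 h2.
by exfalso; have := m10; lra.
Qed.

Lemma small_history_norm d : q * y0 < p * d -> (hist_norm tau (fun t => (phi t - 0)%R) < d%:E)%E.
Proof.
move=> qd; apply: (@le_lt_trans _ _ c%:E); last by rewrite lte_fin history_top_lt.
apply: ge_ereal_sup => _ [t tt <-]; move: tt; rewrite /= in_itv/= => tt.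
have /andP[yt tc] := phi_bounds tt.
by rewrite subr0 lee_fin ger0_norm// (le_trans (ltW y00)).
Qed.

End instability.

Lemma zero_unstable al p q r tau : 0 < al <= 1 -> 0 < p -> p < q -> 0 < r -> 0 <= tau ->
  is_unstable al p q r tau 0.
Proof.
move=> al01 p0 pq r0 tau0 stable.
pose q1 := (p + q) / 2.
have pq1 : p < q1 by rewrite /q1; lra.
have q1q : q1 < q by rewrite /q1; lra.
have [e e0 eP] := feedback_linear_bound (lt_trans p0 pq1) q1q r0.
have [d d0 dP] := stable e e0.
pose e1 := Num.min e d.
have e10 : 0 < e1 by rewrite lt_min e0.
have q0 : 0 < q by exact: lt_trans pq.
(* Gives [q * y0 / p = e1 / 2], which bounds the top of the history: it lies below both the escape
   level [e] and the prescribed size [d]. *)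
pose y0 := p * e1 / (2 * q).
have y00 : 0 < y0 by rewrite divr_gt0 ?mulr_gt0.
have qy0 : q * y0 < p * e1.
  rewrite (_ : q * y0 = p * e1 / 2); last by rewrite /y0; field; rewrite gt_eqF.
  by rewrite gtr_pMr ?mulr_gt0// invf_lt1// ltr1n.
have qe : q * y0 < p * e by rewrite (lt_le_trans qy0)// ler_pM2l// ge_min lexx.
have qd : q * y0 < p * d by rewrite (lt_le_trans qy0)// ler_pM2l// ge_min lexx orbT.
have [x [u [cx dx cu sol xge0]]] := small_history_solution al01 p0 pq1 q1q r0 tau0 y00 qe eP.
have [t t0 ext] := small_history_escape al01 p0 pq1 q1q tau0 y00 qe eP cx dx cu sol xge0.
have := dP _ x sol (small_history_norm p0 pq1 q1q tau0 y00 qe eP qd) t t0.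
by rewrite subr0 ltNge (le_trans ext)// ler_norm.
Qed.

End mackey_glass.

Unset Implicit Arguments.
Set Strict Implicit.
Set Printing Implicit Defensive.

Theorem theorem3p1 (R : realType) (alpha p q r : R)
    (halpha0 : 0 < alpha) (halpha1 : alpha <= 1)
    (hp : 0 < p) (hq : 0 < q) (hr : 0 < r) (hpq : p < q) :
  forall tau : R, 0 <= tau ->
    is_equilibrium alpha p q r tau 0 /\ is_unstable alpha p q r tau 0.
Proof.
move=> tau tau0; split; first exact: zero_equilibrium.
by apply: zero_unstable => //; apply/andP; split.
Qed.
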